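(* Let $\Gamma^m\subset\mathbb R^2$ be a polygonal curve network with vertex vector $X^m\in\mathbb R^{2N_{\rm tot}}$, let $\Delta t>0$, and let $\Lambda=\Lambda_{\Gamma^m}$ (assumed well defined, i.e. the single-layer matrix $V$ of every bounded region is invertible), $\mathcal D_h$, $M_v$, $B_n$, $d_p$ and the signed phase areas $A_p^h:\mathbb R^{2N_{\rm tot}}\to\mathbb R$, $1\le p\le I_P-1$, be as defined in the context. Let $(\mathbf W^{m+1},X^{m+1})\in\mathbb R^{I_PN_{\rm tot}}\times\mathbb R^{2N_{\rm tot}}$ be any solution of \[ (\mathrm I_{I_P}\otimes\Lambda)\mathbf W^{m+1}-\tfrac1{\Delta t}\mathcal D_hM_vB_n(X^{m+1}-X^m)=0, \] and put $\delta X^{m+1}:=X^{m+1}-X^m$ and $v_n^{m+1}:=\frac1{\Delta t}B_n\delta X^{m+1}$. Then for every $1\le p\le I_P-1$ the directional derivative of $A_p^h$ at $X^m$ satisfies \[ \mathrm DA_p^h(X^m)[\delta X^{m+1}]=-\Delta t\,d_p^\top M_vv_n^{m+1}=0, \] and consequently \[ A_p^h(X^{m+1})-A_p^h(X^m)=A_p^h(\delta X^{m+1}). \]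
   Context: **Polygonal network.** $\Gamma^m$ is an embedded network of oriented polygonal curves $\Gamma^m_1,\dots,\Gamma^m_{I_S}$ ($I_S\ge1$), each a simple closed polygon or a simple open polygonal arc. The endpoints of the open curves are exactly the triple junctions ($I_T\ge 0$ of them), at each of which exactly three distinct open curves end; the curves meet nowhere else. The connected components of $\mathbb R^2\setminus\Gamma^m$ are the regions $\mathcal R_1,\dots,\mathcal R_{I_R}$, exactly one of which, $\mathcal R_{I_R}$, is unbounded. Each region is assigned to one of the phases $0,\dots,I_P-1$ ($I_P\ge2$); $\Omega_p$ is the set of indices of regions assigned to phase $p$, and $I_R\in\Omega_0$. Every curve $\Gamma^m_i$ separates two different phases $p_i^-$ and $p_i^+$, and its unit normal, equal to $-\tau^\perp$ for the unit tangent $\tau$ of the orientation ($(a_1,a_2)^\perp=(-a_2,a_1)$), points from $p_i^-$ to $p_i^+$. Thus the boundary of each region is a finite disjoint union of simple closed polygons. $N_{\rm tot}$ is the number of distinct vertices; $X\in\mathbb R^{2N_{\rm tot}}$ lists vertex positions $X_j\in\mathbb R^2$. The vertices of $\Gamma_i^m$ in curve order are $X_{i,k}=X_{\iota_i(k)}$, $1\le k\le N_i$ (both endpoints included if open; periodic index in $k$ if closed), and $N_a=\sum_iN_i$; vectors in $\mathbb R^{N_a}$ are indexed by pairs $(i,k)$. **Signed areas.** For a bounded region $\mathcal R_r$ of $\Gamma^m$, its boundary consists of closed polygons $\Sigma_{r,1},\dots,\Sigma_{r,J_r}$, each oriented so that $\mathcal R_r$ lies locally on its left (outer boundary counterclockwise,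 holes clockwise). Let $\Sigma_{r,q}$ have $N_{r,q}$ vertices; the ordered list of their global vertex indices is fixed by $\Gamma^m$, and for any $X\in\mathbb R^{2N_{\rm tot}}$ the corresponding entries of $X$ are denoted $Y^{(r,q)}_1(X),\dots,Y^{(r,q)}_{N_{r,q}}(X)\in\mathbb R^2$, cyclically indexed. With $a\times b=a_1b_2-a_2b_1$, $\mathcal A_r^h(X)=\frac12\sum_{q=1}^{J_r}\sum_{j=1}^{N_{r,q}}Y_j^{(r,q)}(X)\times Y_{j+1}^{(r,q)}(X)$ and $A_p^h(X)=\sum_{r\in\Omega_p}\mathcal A_r^h(X)$ for $1\le p\le I_P-1$. **Discrete Dirichlet-to-Neumann matrix.** Let $G(x)=-\frac1{2\pi}\log|x|$. For a region $\mathcal R$ with outward unit normal $\nu_{\mathcal R}$ and $\partial\mathcal R$ oriented by $\nu_{\mathcal R}^\perp$, let $E_1,\dots,E_{N_Y}$ be its boundary edges, $\chi_i=\mathbf 1_{E_i}$, and $\varphi_1,\dots,\varphi_{N_X}$ the continuous edgewise affine nodal basis on $\partial\mathcal R$. With the single-layer operator $(\mathcal V\psi)(x)=\int_{\partial\mathcal R}G(x-y)\psi(y)ds_y$, the double-layer boundary operator $(\mathcal K\phi)(x)=\int_{\partial\mathcal R}\partial_{\nu_{\mathcal R}(y)}[G(x-y)]\phi(y)ds_y$ and the hypersingular operator $\mathcal W\phi=-\partial_{\nu_{\mathcal R}}$(double-layer potential of $\phi$), set $V_{ij}=\langle\chi_i,\mathcal V\chi_j\rangle$, $K_{ij}=\langle\chi_i,\mathcal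 K\varphi_j\rangle$, $W_{ij}=\langle\varphi_i,\mathcal W\varphi_j\rangle$, $M_{ij}=\int\chi_i\varphi_j\,ds$; by the Maue identity $W=D^\top VD$, where $\partial_s\varphi_j=\sum_iD_{ij}\chi_i$. Put $J=\frac12M+K$, $\ell=M\mathbf 1_{N_X}$. For bounded $\mathcal R$: $S_{\mathcal R}=W+J^\top V^{-1}J$. For unbounded $\mathcal R$: $S_{\mathcal R}=W+J^\top CJ$, where $Cy=\rho$ is the first component of the unique solution of $V\rho+c\ell=y$, $\ell^\top\rho=0$. With $P_{\mathcal R}$ the restriction of global nodal vectors to the vertices of $\partial\mathcal R$, $\Lambda=\Lambda_{\Gamma^m}=\sum_{r=1}^{I_R}P_{\mathcal R_r}^\top S_{\mathcal R_r}P_{\mathcal R_r}\in\mathbb R^{N_{\rm tot}\times N_{\rm tot}}$. **Incidence, mass, normals.** $m_{p,i}=1$ if $p=p_i^+$, $-1$ if $p=p_i^-$, $0$ otherwise. $\mathcal D_h\in\mathbb R^{I_PN_{\rm tot}\times N_a}$ is defined by $(\mathcal D_h^\top\mathbf W)_{(i,k)}=\sum_{p}m_{p,i}(W_p)_{\iota_i(k)}$ for $\mathbf W=(W_0;\dots;W_{I_P-1})$. $d_p=\mathcal D_h^\top(\mathbf e_p\otimes\mathbf 1_{N_{\rm tot}})\in\mathbb R^{N_a}$, with $\mathbf e_p\in\mathbb R^{I_P}$ the standard basis vector, $(\mathbf e_p)_r=\delta_{pr}$; i.e. $(d_p)_{(i,k)}=m_{p,i}$. With $h_{i,k}=|X^m_{i,k+1}-X^m_{i,k}|$,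 let $\mu_{i,k}=\frac12(h_{i,k-1}+h_{i,k})$, except $\mu_{i,1}=\frac12h_{i,1}$ and $\mu_{i,N_i}=\frac12h_{i,N_i-1}$ at the ends of an open curve; $M_v=\operatorname{diag}(\mu_{i,k})\in\mathbb R^{N_a\times N_a}$. Edge normals: $\nu_{i,k}=-(X^m_{i,k+1}-X^m_{i,k})^\perp/h_{i,k}$. Vertex normals: $\omega_{i,k}=\frac{h_{i,k-1}\nu_{i,k-1}+h_{i,k}\nu_{i,k}}{h_{i,k-1}+h_{i,k}}$, except $\omega_{i,1}=\nu_{i,1}$ and $\omega_{i,N_i}=\nu_{i,N_i-1}$ at the ends of an open curve. $B_n\in\mathbb R^{N_a\times2N_{\rm tot}}$: $(B_nZ)_{(i,k)}=Z_{\iota_i(k)}\cdot\omega_{i,k}$. *)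

(* Defs.v *)
From HB Require Import structures.
From mathcomp Require Import all_boot all_order all_algebra.
From mathcomp Require Import mxtens.
From mathcomp Require Import all_classical all_reals all_analysis.

Set Implicit Arguments.
Unset Strict Implicit.
Unset Printing Implicit Defensive.

Import Order.TTheory GRing.Theory Num.Theory.
Import numFieldNormedType.Exports.

Local Open Scope classical_set_scope.
Local Open Scope ring_scope.

Section Plane.
Context {R : realType}.
Implicit Types a b x y : 'rV[R]_2.

(* The norm `| | of the library on 'rV_2 is the max norm; lengths and the
   Green function use the Euclidean one. *)
Definition enorm x : R := Num.sqrt (x 0 0 ^+ 2 + x 0 1 ^+ 2).

Definition cross a b : R := a 0 0 * b 0 1 - a 0 1 * b 0 0.

Definition perp a : 'rV[R]_2 := \row_c (if c == 0 then - a 0 1 else a 0 0).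

Definition segment_point a b (t : R) : 'rV[R]_2 := a + t *: (b - a).

Definition segment a b : set 'rV[R]_2 :=
  [set segment_point a b t | t in `[0, 1]].

(* - tau^perp: the normal on the right of the edge directed from a to b *)
Definition right_normal a b : 'rV[R]_2 :=
  - ((enorm (b - a))^-1 *: perp (b - a)).

Definition green x : R := - (2 * pi)^-1 * ln (enorm x).

(* X lists the positions X_j of n points: block j of length 2 is X_j. *)
Definition node n (X : 'cV[R]_(n * 2)) (j : 'I_n) : 'rV[R]_2 :=
  \row_c X (mxtens_index (j, c)) 0.

End Plane.

(* Discrete Dirichlet-to-Neumann matrix of a region. [bd] lists its boundary
   polygons as cyclic sequences of vertices, directed so that the region is on
   the left; [right_normal] is then the outward normal and the direction of
   travel is its perp. A function on the boundary is represented edge by edge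
   in the affine parameter of the edge, with values in [`[0, 1]]: this is a
   [bfun]. *)
Section DirichletToNeumann.
Context {R : realType} {n : nat}.
Variables (P : 'I_n -> 'rV[R]_2) (bd : seq (seq 'I_n)).

Definition bverts : seq 'I_n := flatten bd.
Definition bedges : seq ('I_n * 'I_n) :=
  flatten [seq [seq (v, next c v) | v <- c] | c <- bd].

Local Notation NX := (size bverts).
Local Notation NY := (size bedges).

Definition bvert (j : 'I_NX) : 'I_n := tnth (in_tuple bverts) j.
Definition esrc (e : 'I_NY) : 'I_n := (tnth (in_tuple bedges) e).1.
Definition edst (e : 'I_NY) : 'I_n := (tnth (in_tuple bedges) e).2.

Definition elen (e : 'I_NY) : R := enorm (P (edst e) - P (esrc e)).
Definition enormal (e : 'I_NY) := right_normal (P (esrc e)) (P (edst e)).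
Definition epoint (e : 'I_NY) (t : R) :=
  segment_point (P (esrc e)) (P (edst e)) t.

Definition bfun := 'I_NY -> R -> R.

Definition bint (f : bfun) : R :=
  \sum_e elen e * \int[lebesgue_measure]_(t in `[0, 1]) f e t.

Definition pairing (f g : bfun) : R := bint (fun e t => f e t * g e t).

Definition on_bd (u : 'rV[R]_2 -> R) : bfun := fun e t => u (epoint e t).

Definition chi (i : 'I_NY) : bfun := fun e _ => (e == i)%:R.

Definition hat (j : 'I_NX) : bfun := fun e t =>
  (1 - t) * (esrc e == bvert j)%:R + t * (edst e == bvert j)%:R.

Definition single_layer (psi : bfun) (x : 'rV[R]_2) : R :=
  bint (fun e t => green (x - epoint e t) * psi e t).

(* Evaluated off the boundary this is the double-layer potential, on the
   boundary it is the double-layer boundary operator (direct value). *)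
Definition double_layer (phi : bfun) (x : 'rV[R]_2) : R :=
  bint (fun e t =>
    'D_(enormal e) (fun y => green (x - y)) (epoint e t) * phi e t).

(* The normal derivative on the boundary is the limit from inside the region. *)
Definition hypersingular (phi : bfun) : bfun := fun e t =>
  - lim ('D_(enormal e) (double_layer phi) (epoint e t - d *: enormal e)
         @[d --> 0^'+]).

Definition Vmx : 'M[R]_NY :=
  \matrix_(i, j) pairing (chi i) (on_bd (single_layer (chi j))).
Definition Kmx : 'M[R]_(NY, NX) :=
  \matrix_(i, j) pairing (chi i) (on_bd (double_layer (hat j))).
Definition Wmx : 'M[R]_NX :=
  \matrix_(i, j) pairing (hat i) (hypersingular (hat j)).
Definition Mmx : 'M[R]_(NY, NX) := \matrix_(i, j) pairing (chi i) (hat j).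
Definition Jmx : 'M[R]_(NY, NX) := 2^-1 *: Mmx + Kmx.
Definition ell : 'cV[R]_NY := Mmx *m const_mx 1.

Definition is_saddle_inverse (C : 'M[R]_NY) : Prop :=
  forall y, exists c, forall rho c',
    Vmx *m rho + c' *: ell = y /\ ell^T *m rho = 0 <->
    rho = C *m y /\ c' = c.

(* There is exactly one such matrix, because Vmx is positive definite on the
   densities with zero total charge; 0 is only the default that [xget] needs. *)
Definition Cmx : 'M[R]_NY := xget 0 [set C | is_saddle_inverse C].

Definition dtn_bounded : 'M[R]_NX := Wmx + Jmx^T *m invmx Vmx *m Jmx.
Definition dtn_unbounded : 'M[R]_NX := Wmx + Jmx^T *m Cmx *m Jmx.

Definition restriction_mx : 'M[R]_(NX, n) := \matrix_(a, j) (bvert a == j)%:R.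

End DirichletToNeumann.

(* Curves, vertices, phases and regions are numbered from 0. The bounded
   regions come first, region [ord_max] is the unbounded one. [vidx i k] is the
   global index of the k-th vertex of curve i, and [bdry r] lists the boundary
   polygons of region r. *)
Record network (R : realType) := Network {
  ncurves : nat;
  nverts : nat;
  nphases : nat;
  nbounded : nat;
  csize : 'I_ncurves -> nat;
  is_closed : pred 'I_ncurves;
  vidx : forall i : 'I_ncurves, 'I_(csize i) -> 'I_nverts;
  vpos : 'cV[R]_(nverts * 2);
  phase_neg : 'I_ncurves -> 'I_nphases;
  phase_pos : 'I_ncurves -> 'I_nphases;
  region : 'I_nbounded.+1 -> set 'rV[R]_2;
  phase_of : 'I_nbounded.+1 -> 'I_nphases;
  bdry : 'I_nbounded.+1 -> seq (seq 'I_nverts)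
}.

Arguments is_closed {R} _ _.
Arguments vidx {R _ i} k.
Arguments phase_neg {R _} i.
Arguments phase_pos {R _} i.
Arguments phase_of {R _} r.
Arguments bdry {R _} r.

Section Network.
Context {R : realType} (G : network R).

Local Notation N := (nverts G).
Local Notation IP := (nphases G).
Local Notation NA := (\sum_(i < ncurves G) csize i)%N.
Local Notation vtx := (node (vpos G)).

Definition is_edge (i : 'I_(ncurves G)) (k : 'I_(csize i)) : bool :=
  is_closed G i || (k.+1 < csize i)%N.

Definition is_end (i : 'I_(ncurves G)) (k : 'I_(csize i)) : bool :=
  ~~ is_closed G i && ((k == 0%N :> nat) || (k.+1 == csize i)).

Definition edge_src (i : 'I_(ncurves G)) (k : 'I_(csize i)) := vtx (vidx k).
Definition edge_dst (i : 'I_(ncurves G)) (k : 'I_(csize i)) :=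
  vtx (vidx (ordS k)).
Definition edge_seg (i : 'I_(ncurves G)) (k : 'I_(csize i)) :=
  segment (edge_src k) (edge_dst k).

Definition carrier : set 'rV[R]_2 :=
  [set x | exists i (k : 'I_(csize i)), is_edge k /\ edge_seg k x].

Definition adjacent (u v : 'I_N) : Prop :=
  exists i (k : 'I_(csize i)), is_edge k /\
    ((u = vidx k /\ v = vidx (ordS k)) \/ (v = vidx k /\ u = vidx (ordS k))).

Definition in_phase (p : 'I_IP) : set 'rV[R]_2 :=
  [set x | exists2 r, phase_of r = p & region r x].

(* The boundary of region r is the disjoint union of the simple closed polygons
   of [bd], which list all the vertices of the network on them and have the
   region on their left. *)
Record boundary_polygons (r : 'I_(nbounded G).+1) (bd : seq (seq 'I_N)) : Prop :=
  BoundaryPolygons {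
  bd_uniq : uniq (flatten bd);
  bd_size : forall c, c \in bd -> (2 < size c)%N;
  bd_edge : forall c v, c \in bd -> v \in c -> adjacent v (next c v);
  bd_left : forall c v (t : R), c \in bd -> v \in c -> 0 < t < 1 ->
    \forall d \near 0^'+,
      region r (segment_point (vtx v) (vtx (next c v)) t
                - d *: right_normal (vtx v) (vtx (next c v)));
  bd_cover :
    [set x | exists c v, [/\ c \in bd, v \in c
                          & segment (vtx v) (vtx (next c v)) x]]
    = closure (region r) `\` interior (region r)
}.

Record polygonal_network : Prop := PolygonalNetwork {
  pn_ncurves : (0 < ncurves G)%N;
  pn_nphases : (1 < nphases G)%N;
  pn_vertex_inj : injective vtx;
  pn_vertex_used : forall j, exists i (k : 'I_(csize i)), vidx k = j :> 'I_N;
  pn_csize : forall i : 'I_(ncurves G),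
    ((if is_closed G i then 2 else 1) < csize i)%N;
  pn_vidx_inj : forall i : 'I_(ncurves G), injective (@vidx R G i);
  (* distinct edges meet only at common end vertices *)
  pn_embedded : forall i (k : 'I_(csize i)) i' (k' : 'I_(csize i')) x,
    is_edge k -> is_edge k' ->
    Tagged (fun i => 'I_(csize i)) k != Tagged (fun i => 'I_(csize i)) k' ->
    edge_seg k x -> edge_seg k' x ->
    exists j : 'I_N, [/\ x = vtx j, j \in [:: vidx k; vidx (ordS k)]
                       & j \in [:: vidx k'; vidx (ordS k')]];
  (* distinct curves share only end points of open curves *)
  pn_curves_meet : forall i (k : 'I_(csize i)) i' (k' : 'I_(csize i')),
    i != i' -> vidx k = vidx k' :> 'I_N -> is_end k && is_end k';
  pn_triple : forall i (k : 'I_(csize i)), is_end k ->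
    #|[pred i' : 'I_(ncurves G) |
        [exists k' : 'I_(csize i'), is_end k' && (vidx k' == vidx k :> 'I_N)]]|
    = 3;
  pn_region_inj : injective (@region R G);
  pn_regions : range (@region R G) =
    [set connected_component (~` carrier) x | x in ~` carrier];
  pn_bounded : forall r : 'I_(nbounded G).+1,
    bounded_set (region r) <-> r != ord_max;
  pn_phase_unbounded : phase_of (ord_max : 'I_(nbounded G).+1) = 0%N :> nat;
  pn_phases_neq : forall i : 'I_(ncurves G), phase_neg i != phase_pos i;
  pn_sides : forall i (k : 'I_(csize i)) (t : R), is_edge k -> 0 < t < 1 ->
    let x := segment_point (edge_src k) (edge_dst k) t in
    let nu := right_normal (edge_src k) (edge_dst k) in
    \forall d \near 0^'+, in_phase (phase_pos i) (x + d *: nu) /\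
                          in_phase (phase_neg i) (x - d *: nu);
  pn_boundary : forall r, boundary_polygons r (bdry r)
}.

Definition region_area (r : 'I_(nbounded G).+1) (X : 'cV[R]_(N * 2)) : R :=
  2^-1 * \sum_(c <- bdry r) \sum_(v <- c) cross (node X v) (node X (next c v)).

Definition phase_area (p : 'I_IP) (X : 'cV[R]_(N * 2)) : R :=
  \sum_(r < (nbounded G).+1 | phase_of r == p) region_area r X.

Definition region_single_layer_mx (r : 'I_(nbounded G).+1) :=
  Vmx vtx (bdry r).

Definition region_dtn (r : 'I_(nbounded G).+1) :=
  if r == ord_max then dtn_unbounded vtx (bdry r)
  else dtn_bounded vtx (bdry r).

Definition Lambda : 'M[R]_N :=
  \sum_(r < (nbounded G).+1)
    (restriction_mx (bdry r))^T *m region_dtn r *m restriction_mx (bdry r).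

Definition incidence (p : 'I_IP) (i : 'I_(ncurves G)) : R :=
  if p == phase_pos i then 1 else if p == phase_neg i then - 1 else 0.

(* Vectors indexed by pairs (i, k) use the bijection [tagnat.sig]. *)
Definition cidx (a : 'I_NA) : 'I_(ncurves G) := tagnat.sig1 a.
Definition kidx (a : 'I_NA) : 'I_(csize (cidx a)) := tagnat.sig2 a.

Definition Dh : 'M[R]_(IP * N, NA) :=
  \matrix_(b, a) (incidence (mxtens_unindex b).1 (cidx a) *
                  (vidx (kidx a) == (mxtens_unindex b).2)%:R).

Definition dvec (p : 'I_IP) : 'cV[R]_NA :=
  Dh^T *m ((delta_mx p 0 : 'cV[R]_IP) *t (const_mx 1 : 'cV[R]_N)).

Definition hlen (i : 'I_(ncurves G)) (k : 'I_(csize i)) : R :=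
  enorm (edge_dst k - edge_src k).

Definition edge_normal (i : 'I_(ncurves G)) (k : 'I_(csize i)) : 'rV[R]_2 :=
  right_normal (edge_src k) (edge_dst k).

(* [ordS] and [ord_pred] are cyclic; on open curves only the two end vertices
   would see the wrap-around, and they are treated apart. *)
Definition mu (i : 'I_(ncurves G)) (k : 'I_(csize i)) : R :=
  if is_end k then
    if k == 0%N :> nat then 2^-1 * hlen k else 2^-1 * hlen (ord_pred k)
  else 2^-1 * (hlen (ord_pred k) + hlen k).

Definition vertex_normal (i : 'I_(ncurves G)) (k : 'I_(csize i)) : 'rV[R]_2 :=
  if is_end k then
    if k == 0%N :> nat then edge_normal k else edge_normal (ord_pred k)
  else (hlen (ord_pred k) + hlen k)^-1 *:
    (hlen (ord_pred k) *: edge_normal (ord_pred k) + hlen k *: edge_normal k).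

Definition Mv : 'M[R]_NA := diag_mx (\row_a mu (kidx a)).

Definition Bn : 'M[R]_(NA, N * 2) :=
  \matrix_(a, b) ((vidx (kidx a) == (mxtens_unindex b).1)%:R *
                  vertex_normal (kidx a) 0 (mxtens_unindex b).2).

End Network.

Arguments phase_area {R} G p X.
Arguments region_single_layer_mx {R} G r.

(* Main.v *)
(* The discrete Dirichlet-to-Neumann map annihilates constants from the left,
   1^T S = 0 on every region, and this is what conserves the areas.  By Maue's
   identity 1^T W telescopes along each closed boundary polygon.  The vector J 1
   is a multiple of the edge length vector l: the double-layer potential of 1 is
   the total angle subtended by the boundary, which is constant on the connected
   region, so by the jump relation it takes the same value at all edge points.
   On an unbounded region l^T C = 0, so 1^T J^T C = 0 whatever the multiple.  On
   a bounded region J 1 = 0: a line normal to an edge is followed to its last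
   crossing of the boundary, beyond which the total angle is constant and tends
   to 0, and stepping back onto the crossed edge changes it by pi, which is
   K 1 = - l / 2.
   Summing over the regions, 1^T Lambda = 0, and the equation for W gives
   d_p^T M_v B_n dX = 0.

   The signed area of phase p is a sum of cross products over the curve edges,
   each traversed with p on its left.  Its polarization at (X^m, dX) differs from
   - d_p^T M_v B_n dX by a telescoping sum, so the derivative of the area is that
   flux, and as the area is a quadratic form in X the last claim follows. *)

Require Import Defs.
From mathcomp Require Import all_boot all_order all_algebra.
From mathcomp Require Import mxtens ring lra.
From mathcomp Require Import all_classical all_reals all_analysis.
From mathcomp Require Import measurable_realfun.
Import Order.TTheory GRing.Theory Num.Theory.
Import numFieldNormedType.Exports.
Set Implicit Arguments.
Unset Strict Implicit.
Unset Printing Implicit Defensive.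
Local Open Scope classical_set_scope.
Local Open Scope ring_scope.

(** * Real derivatives and the argument function *)

Section RealDerivatives.
Context {R : realType}.
Implicit Types (f g : R -> R) (x df dg : R).

(** The layer operators are given as genuine integrals and limits that are singular on the boundary,
    so the proof runs on closed forms. For an affine density on one edge the double-layer potential
    is [dlpot], made of the subtended angle and the logarithms of the distances to the ends. After
    the end terms have cancelled around the polygons, a quarter turn changes its normal derivative
    at an edge into the derivative of [slpot] along that edge. No differentiation under an integral
    sign occurs, and each edge integral of the hypersingular operator becomes a difference of end
    values. Two places are delicate. An edge seen from its own points: the angle is set to 0 on
    collinear vectors, which is the direct value of the double layer there, and in the other
    formulas the jumping angle carries a vanishing factor. The vertices: integrands blow up
    logarithmically, so integrability and the fundamental theorem are set up on the open unit
    interval, with primitives continuous up to its ends. On a bounded region the constant angle at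
    edge points must be exactly [pi]: only then does [kappa / (2 * pi)] cancel the 1/2 in [Jmx]. *)

Lemma is_derive_fD f g x df dg : is_derive x 1 f df -> is_derive x 1 g dg ->
  is_derive x 1 (fun t => f t + g t) (df + dg).
Proof. exact: is_deriveD. Qed.

Lemma is_derive_fN f x df : is_derive x 1 f df ->
  is_derive x 1 (fun t => - f t) (- df).
Proof. exact: is_deriveN. Qed.

Lemma is_derive_fB f g x df dg : is_derive x 1 f df -> is_derive x 1 g dg ->
  is_derive x 1 (fun t => f t - g t) (df - dg).
Proof. exact: is_deriveB. Qed.

Lemma is_derive_fM f g x df dg : is_derive x 1 f df -> is_derive x 1 g dg ->
  is_derive x 1 (fun t => f t * g t) (f x * dg + g x * df).
Proof. by move=> ? ?; apply: is_deriveM. Qed.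

Lemma is_derive_fZ f x df (c : R) : is_derive x 1 f df ->
  is_derive x 1 (fun t => c * f t) (c * df).
Proof. exact: is_deriveZ. Qed.

Lemma is_derive_fsqrt f x df : is_derive x 1 f df -> 0 < f x ->
  is_derive x 1 (fun t => Num.sqrt (f t)) (df / (2 * Num.sqrt (f x))).
Proof.
move=> Df f0; have H := @is_derive1_comp _ _ f x _ _ (is_derive1_sqrt f0) Df.
by apply: is_derive_eq H _; rewrite mulrC.
Qed.

Lemma is_derive_fln f x df : is_derive x 1 f df -> 0 < f x ->
  is_derive x 1 (fun t => ln (f t)) (df / f x).
Proof.
move=> Df f0; have H := @is_derive1_comp _ _ f x _ _ (is_derive1_ln f0) Df.
by apply: is_derive_eq H _; rewrite mulrC.
Qed.

Lemma is_derive_fatan f x df : is_derive x 1 f df ->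
  is_derive x 1 (fun t => atan (f t)) (df / (1 + f x ^+ 2)).
Proof.
move=> Df; have H := @is_derive1_comp _ _ f x _ _ (is_derive1_atan (f x)) Df.
by apply: is_derive_eq H _; rewrite mulrC.
Qed.

Lemma is_derive_fV f x df : is_derive x 1 f df -> f x != 0 ->
  is_derive x 1 (fun t => (f t)^-1) (- df / f x ^+ 2).
Proof.
move=> Df f0; have H := @is_deriveV _ f x df 1 f0 Df.
by apply: is_derive_eq H _; rewrite /GRing.scale /= mulrC mulrN mulNr.
Qed.

Lemma is_derive_fsum (I : Type) (s : seq I) (h : I -> R -> R) x (dh : I -> R) :
  (forall i, is_derive x 1 (h i) (dh i)) ->
  is_derive x 1 (fun t => \sum_(i <- s) h i t) (\sum_(i <- s) dh i).
Proof.
move=> Hh; elim: s => [|i s IH].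
  rewrite big_nil (_ : (fun _ => _) = cst 0); first exact: is_derive_cst.
  by apply/funext => t; rewrite big_nil.
rewrite big_cons (_ : (fun _ => _) = fun t => h i t + \sum_(j <- s) h j t).
  exact: is_derive_fD.
by apply/funext => t; rewrite big_cons.
Qed.

Lemma is_derive_affine (c d : R) x : is_derive x 1 (fun t => c + t * d) d.
Proof.
have H := is_derive_fD (is_derive_cst c x 1)
  (is_derive_fM (is_derive_id x 1) (is_derive_cst d x 1)).
by apply: is_derive_eq H _; rewrite mulr0 mulr1 !add0r.
Qed.

Lemma is_derive_continuous f x df : is_derive x 1 f df -> {for x, continuous f}.
Proof. by case=> dx _; apply/differentiable_continuous/derivable1_diffP. Qed.

(** The half-angle formula tan(theta / 2) = y / (|z| + x): a single expression, smooth off the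
    closed negative real axis. On that axis the quotient is 0 / 0, which evaluates to 0, so
    [arg2 x 0] is 0 for every [x]. *)
Definition arg2 (x y : R) : R := 2 * atan (y / (Num.sqrt (x ^+ 2 + y ^+ 2) + x)).

Lemma arg2_den_gt0 (x y : R) : (0 < x) || (y != 0) ->
  0 < Num.sqrt (x ^+ 2 + y ^+ 2) + x.
Proof.
move=> /orP[x0|y0]; first by rewrite ltr_wpDl// sqrtr_ge0.
have [x0|x0] := ltP 0 x; first by rewrite ltr_wpDl// sqrtr_ge0.
rewrite -ltrBlDr sub0r -(ler0_norm x0) -sqrtr_sqr ltr_sqrt.
  by rewrite ltrDl lt0r sqrf_eq0 y0 sqr_ge0.
by rewrite ltr_wpDl ?sqr_ge0// lt0r sqrf_eq0 y0 sqr_ge0.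
Qed.

(** The left side is what the chain rule gives for [arg2], with the radius as an atom [Q]. The
    half-angle relation 1 + tan^2 = 2 Q / (Q + F) collapses it to the derivative of the polar
    angle. *)
Lemma arg2_derivative_identity (F G dF dG Q : R) :
  Q ^+ 2 = F ^+ 2 + G ^+ 2 -> Q != 0 -> Q + F != 0 ->
  2 * ((G * (- (2 * (F * dF + G * dG) / (2 * Q) + dF) / (Q + F) ^+ 2)
        + (Q + F)^-1 * dG) / (1 + (G / (Q + F)) ^+ 2))
  = (F * dG - G * dF) / (F ^+ 2 + G ^+ 2).
Proof.
move=> QE Q0 D0; rewrite -QE.
have gE : G ^+ 2 = Q ^+ 2 - F ^+ 2 by rewrite QE; ring.
have -> : 1 + (G / (Q + F)) ^+ 2 = 2 * Q / (Q + F).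
  by rewrite expr_div_n gE; field.
(* The remaining square of [G] is traded for [Q ^+ 2 - F ^+ 2]; what is left is an identity of
   rational functions. *)
have -> : G * (- (2 * (F * dF + G * dG) / (2 * Q) + dF) / (Q + F) ^+ 2) =
    (- (G * F * dF + (Q ^+ 2 - F ^+ 2) * dG) / Q - G * dF) / (Q + F) ^+ 2.
  rewrite -gE; by field; rewrite Q0 D0.
by field; rewrite Q0 D0.
Qed.

Lemma is_derive_arg2 f g x df dg : is_derive x 1 f df -> is_derive x 1 g dg ->
  (0 < f x) || (g x != 0) ->
  is_derive x 1 (fun t => arg2 (f t) (g t))
    ((f x * dg - g x * df) / (f x ^+ 2 + g x ^+ 2)).
Proof.
move=> Df Dg reg; have den := arg2_den_gt0 reg.
have S0 : 0 < f x ^+ 2 + g x ^+ 2.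
  case/orP: reg => [f0|g0].
    by rewrite ltr_pwDl ?sqr_ge0// exprn_gt0.
  by rewrite ltr_wpDl ?sqr_ge0// lt0r sqrf_eq0 g0 sqr_ge0.
have DS : is_derive x 1 (fun t => f t ^+ 2 + g t ^+ 2) (2 * (f x * df + g x * dg)).
  have H := is_derive_fD (is_derive_fM Df Df) (is_derive_fM Dg Dg).
  by apply: is_derive_eq H _; ring.
have DD := is_derive_fD (is_derive_fsqrt DS S0) Df.
have DV := is_derive_fV DD (lt0r_neq0 den).
have DA := is_derive_fZ 2 (is_derive_fatan (is_derive_fM Dg DV)).
apply: is_derive_eq DA _.
apply: arg2_derivative_identity => //.
- by rewrite sqr_sqrtr// ltW.
- by rewrite gt_eqF ?sqrtr_gt0.
- by rewrite gt_eqF.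
Qed.

End RealDerivatives.

(** * Signed angles between plane vectors *)

Section Angles.
Context {R : realType}.
Implicit Types (a b e m n p q : 'rV[R]_2) (s t : R).

Definition dot a b : R := a 0 0 * b 0 0 + a 0 1 * b 0 1.

(** In complex notation, the argument of conj(p) q: the signed angle from [p] to [q] at the
    origin. *)
Definition angle p q : R := arg2 (dot p q) (cross p q).

Definition lnorm p : R := ln (enorm p).

(* The origin does not lie on the closed segment from p to q. *)
Definition visible p q : bool := (0 < dot p q) || (cross p q != 0).

Lemma dotxx_ge0 p : 0 <= dot p p.
Proof. by rewrite /dot -!expr2 addr_ge0 ?sqr_ge0. Qed.

Lemma dotxx_eq0 p : (dot p p == 0) = (p == 0).
Proof.
apply/idP/eqP => [|->]; last by rewrite /dot !mxE !mul0r addr0.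
rewrite /dot -!expr2 paddr_eq0 ?sqr_ge0// !sqrf_eq0 => /andP[/eqP p0 /eqP p1].
apply/rowP => i; rewrite mxE; have [->|->]// : i = 0 \/ i = 1.
by case: i => -[|[|]]//= H; [left|right]; apply/val_inj.
Qed.

Lemma dotxx_gt0 p : (0 < dot p p) = (p != 0).
Proof. by rewrite lt0r dotxx_ge0 andbT dotxx_eq0. Qed.

Lemma enorm_sqrt p : enorm p = Num.sqrt (dot p p).
Proof. by rewrite /enorm /dot !expr2. Qed.

Lemma enorm_gt0 p : (0 < enorm p) = (p != 0).
Proof. by rewrite enorm_sqrt sqrtr_gt0 dotxx_gt0. Qed.

Lemma sqr_enorm p : enorm p ^+ 2 = dot p p.
Proof. by rewrite enorm_sqrt sqr_sqrtr// dotxx_ge0. Qed.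

Lemma enormZ t p : enorm (t *: p) = `|t| * enorm p.
Proof.
rewrite !enorm_sqrt (_ : dot (t *: p) _ = t ^+ 2 * dot p p).
  by rewrite sqrtrM ?sqr_ge0// sqrtr_sqr.
by rewrite /dot !mxE; ring.
Qed.

Lemma dot_cross_sqr p q : dot p q ^+ 2 + cross p q ^+ 2 = dot p p * dot q q.
Proof. by rewrite /dot /cross; ring. Qed.

Lemma visible_neq0 p q : visible p q -> (p != 0) && (q != 0).
Proof.
move=> v; rewrite -negb_or; apply/negP => /orP[]/eqP z; move: v;
by rewrite /visible z /dot /cross !mxE ?mul0r ?mulr0 addr0 subrr ltxx eqxx.
Qed.

(** The derivative is the rate of turn of the second vector minus that of the first. This split into
    one term per end point is what makes sums over closed polygons telescope. *)
Lemma is_derive_angle_line p0 m q0 k t :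
  visible (p0 + t *: m) (q0 + t *: k) ->
  is_derive t 1 (fun s => angle (p0 + s *: m) (q0 + s *: k))
   (cross (q0 + t *: k) k / dot (q0 + t *: k) (q0 + t *: k)
    - cross (p0 + t *: m) m / dot (p0 + t *: m) (p0 + t *: m)).
Proof.
move=> vis; have /andP[p0' q0'] := visible_neq0 vis.
have crd (x y : 'rV[R]_2) i : is_derive t 1 (fun s => (x + s *: y) 0 i) (y 0 i).
  rewrite (_ : (fun _ => _) = fun s => x 0 i + s * y 0 i).
    exact: is_derive_affine.
  by apply/funext => s; rewrite !mxE.
have Dd := is_derive_fD (is_derive_fM (crd p0 m 0) (crd q0 k 0))
                        (is_derive_fM (crd p0 m 1) (crd q0 k 1)).
have Dc := is_derive_fB (is_derive_fM (crd p0 m 0) (crd q0 k 1))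
                        (is_derive_fM (crd p0 m 1) (crd q0 k 0)).
have DA := is_derive_arg2 Dd Dc vis.
apply: is_derive_eq DA _.
(* By Lagrange's identity the denominator is |p|^2 |q|^2, the common denominator of the two rates of
   turn. *)
rewrite -/(dot _ _) -/(cross _ _) dot_cross_sqr.
move: p0' q0'; rewrite -!dotxx_eq0.
move: (p0 + t *: m) (q0 + t *: k) => p q p0' q0'.
have pd : dot p p != 0 by [].
have qd : dot q q != 0 by [].
rewrite -[- (cross p m / _)]mulNr addf_div// [dot q q * _]mulrC.
by congr (_ / _); rewrite /dot /cross; ring.
Qed.

Lemma is_derive_lnorm_line p0 m t : p0 + t *: m != 0 ->
  is_derive t 1 (fun s => lnorm (p0 + s *: m))
    (dot (p0 + t *: m) m / dot (p0 + t *: m) (p0 + t *: m)).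
Proof.
move=> p0'.
have crd (x y : 'rV[R]_2) i : is_derive t 1 (fun s => (x + s *: y) 0 i) (y 0 i).
  rewrite (_ : (fun _ => _) = fun s => x 0 i + s * y 0 i).
    exact: is_derive_affine.
  by apply/funext => s; rewrite !mxE.
have Dd := is_derive_fD (is_derive_fM (crd p0 m 0) (crd p0 m 0))
                        (is_derive_fM (crd p0 m 1) (crd p0 m 1)).
have dp : 0 < dot (p0 + t *: m) (p0 + t *: m) by rewrite dotxx_gt0.
have DL := is_derive_fln (is_derive_fsqrt Dd dp) _.
rewrite /= (_ : (fun _ => _) =
    fun s => ln (Num.sqrt (dot (p0 + s *: m) (p0 + s *: m)))); last first.
  by apply/funext => s; rewrite /lnorm enorm_sqrt.
apply: is_derive_eq (DL _) _; first by rewrite sqrtr_gt0.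
rewrite -/(dot _ _); set Q := Num.sqrt _.
have Q0 : Q != 0 by rewrite gt_eqF// sqrtr_gt0.
rewrite -[in RHS](sqr_sqrtr (dotxx_ge0 _)) -/Q /dot.
by field.
Qed.

Lemma normr_arg2_le (x y : R) : `|arg2 x y| <= pi.
Proof.
have := atan_gtNpi2 (y / (Num.sqrt (x ^+ 2 + y ^+ 2) + x)).
have := atan_ltpi2 (y / (Num.sqrt (x ^+ 2 + y ^+ 2) + x)).
by rewrite /arg2 ler_norml; move: (atan _) => u; lra.
Qed.

Lemma arg2_eq0 (x : R) : arg2 x 0 = 0.
Proof. by rewrite /arg2 mul0r atan0 mulr0. Qed.

Lemma atanV (x : R) : 0 < x -> atan x^-1 = pi / 2 - atan x.
Proof.
move=> x0; have := atan_ltpi2 x; have := atan_gtNpi2 x => l u.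
have a0 : 0 < atan x by rewrite -(@atan0 R) lt_atan.
apply: tan_inj.
- by rewrite in_itv/= atan_gtNpi2 atan_ltpi2.
- by rewrite in_itv/=; apply/andP; split; lra.
rewrite atanK /tan sinB cosB sin_pihalf cos_pihalf !mul0r mul1r subr0 add0r.
by rewrite mul1r -[in LHS](atanK x) /tan invf_div.
Qed.

(* As [arg2] is odd in [y], it jumps by [2 * pi] across the negative real axis. *)
Lemma arg2_neg (x y : R) : x < 0 -> 0 < y ->
  arg2 x y = pi - 2 * atan (y / (Num.sqrt (x ^+ 2 + y ^+ 2) - x)).
Proof.
move=> x0 y0; rewrite /arg2.
have d0 : 0 < Num.sqrt (x ^+ 2 + y ^+ 2) + x by rewrite arg2_den_gt0// gt_eqF ?orbT.
have S : Num.sqrt (x ^+ 2 + y ^+ 2) ^+ 2 = x ^+ 2 + y ^+ 2.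
  by rewrite sqr_sqrtr// addr_ge0// sqr_ge0.
set Q := Num.sqrt _ in d0 S *.
have d1 : 0 < Q - x by rewrite ltr_wpDl ?sqrtr_ge0// oppr_gt0.
(* The two half-angle tangents are reciprocal because (Q + x)(Q - x) = y^2. *)
have -> : y / (Q + x) = (y / (Q - x))^-1.
  rewrite invf_div; apply/eqP; rewrite eqr_div ?(lt0r_neq0 d0) ?(gt_eqF y0)//.
  by rewrite -subr_sqr S expr2 addrAC subrr add0r.
by rewrite atanV ?divr_gt0//; field.
Qed.

Lemma arg2N (x y : R) : arg2 x (- y) = - arg2 x y.
Proof. by rewrite /arg2 sqrrN mulNr atanN mulrN. Qed.

End Angles.

(** * Integrals over the unit interval *)

Section UnitIntervalIntegral.
Context {R : realType}.
Implicit Types (f g F : R -> R) (t : R).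
Local Notation mu := (@lebesgue_measure R).

(** The open interval is used because the integrands below are controlled only there: they may be
    singular at the ends, which correspond to vertices. *)
Definition integrable01 f := mu.-integrable `]0, 1[ (EFin \o f).

Lemma int01_open f : integrable01 f ->
  \int[mu]_(t in `[0, 1]) f t = \int[mu]_(t in `]0, 1[) f t.
Proof.
move=> fi; rewrite /Rintegral integral_itv_bndoo//.
exact: (measurable_int mu).
Qed.

Lemma eq_integrable01 f g : (forall t, 0 < t < 1 -> f t = g t) ->
  integrable01 f -> integrable01 g.
Proof.
move=> fg; apply: eq_integrable => // t; rewrite inE/= in_itv/= => t01.
by rewrite fg.
Qed.

Lemma eq_int01 f g : (forall t, 0 < t < 1 -> f t = g t) -> integrable01 f ->
  \int[mu]_(t in `[0, 1]) f t = \int[mu]_(t in `[0, 1]) g t.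
Proof.
move=> fg fi; rewrite !int01_open//; last exact: eq_integrable01 fi.
by apply: eq_Rintegral => t; rewrite inE/= in_itv/= => /fg.
Qed.

Lemma integrable01Z (c : R) f : integrable01 f -> integrable01 (fun t => c * f t).
Proof.
move=> fi; have := integrableZl (mu := mu) (measurable_itv `]0, 1[) c fi.
by apply: eq_integrable => // t _; rewrite /= EFinM.
Qed.

Lemma integrable01D f g : integrable01 f -> integrable01 g ->
  integrable01 (fun t => f t + g t).
Proof.
move=> fi gi; have := integrableD (mu := mu) (measurable_itv `]0, 1[) fi gi.
by apply: eq_integrable.
Qed.

Lemma integrable01B f g : integrable01 f -> integrable01 g ->
  integrable01 (fun t => f t - g t).
Proof.
move=> fi gi; have := integrable01D fi (integrable01Z (-1) gi).
by apply: eq_integrable01 => t _; rewrite mulN1r.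
Qed.

Lemma integrable01_sum (I : Type) (s : seq I) (h : I -> R -> R) :
  (forall i, integrable01 (h i)) -> integrable01 (fun t => \sum_(i <- s) h i t).
Proof.
move=> hi; have := integrable_sum (mu := mu) (measurable_itv `]0, 1[) s
  (P := xpredT) (h := fun i => EFin \o h i) (fun i _ => hi i).
by apply: eq_integrable => // t _ /=; rewrite sumEFin.
Qed.

Lemma int01Z (c : R) f : integrable01 f ->
  \int[mu]_(t in `[0, 1]) (c * f t) = c * \int[mu]_(t in `[0, 1]) f t.
Proof.
by move=> fi; rewrite !int01_open ?RintegralZl//; exact: integrable01Z.
Qed.

Lemma int01D f g : integrable01 f -> integrable01 g ->
  \int[mu]_(t in `[0, 1]) (f t + g t) =
  \int[mu]_(t in `[0, 1]) f t + \int[mu]_(t in `[0, 1]) g t.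
Proof.
by move=> fi gi; rewrite !int01_open ?RintegralD//; exact: integrable01D.
Qed.

Lemma int01_cst (c : R) : \int[mu]_(t in `[0, 1]) c = c.
Proof.
rewrite Rintegral_cst// (_ : fine _ = 1) ?mulr1//.
by have := lebesgue_measure_itv `[(0 : R), 1]; rewrite /= lte_fin ltr01 oppr0 adde0 => ->.
Qed.

Lemma int01_sum (I : Type) (s : seq I) (h : I -> R -> R) :
  (forall i, integrable01 (h i)) ->
  \int[mu]_(t in `[0, 1]) (\sum_(i <- s) h i t) =
  \sum_(i <- s) \int[mu]_(t in `[0, 1]) h i t.
Proof.
move=> hi; elim: s => [|i s IH].
  by rewrite big_nil; under eq_Rintegral do rewrite big_nil; rewrite int01_cst.
rewrite big_cons -IH -int01D//; last exact: integrable01_sum.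
by apply: eq_Rintegral => t _; rewrite big_cons.
Qed.

Lemma measurable01 f : (forall t, 0 < t < 1 -> {for t, continuous f}) ->
  measurable_fun (`]0, 1[%classic : set R) f.
Proof.
move=> fc; apply: open_continuous_measurable_fun; first exact: interval_open.
by move=> t; rewrite inE/= in_itv/= => /fc.
Qed.

Lemma integrable01_bounded f (C : R) :
  (forall t, 0 < t < 1 -> {for t, continuous f}) ->
  (forall t, 0 < t < 1 -> `|f t| <= C) -> integrable01 f.
Proof.
move=> fc fC; apply: measurable_bounded_integrable => //.
- have := lebesgue_measure_itv `](0 : R), 1[;
    rewrite /= lte_fin ltr01 oppr0 adde0 => ->; exact: ltry.
- exact: measurable01.
- exists C; split; first by rewrite num_real.
  by move=> x Cx t /=; rewrite in_itv/= => /fC /le_trans; apply; exact: ltW.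
Qed.

Lemma integrable01M f g (C : R) :
  (forall t, 0 < t < 1 -> {for t, continuous f}) ->
  (forall t, 0 < t < 1 -> `|f t| <= C) -> integrable01 g ->
  integrable01 (fun t => f t * g t).
Proof.
move=> fc fC gi.
have := @integrableMr _ _ _ mu _ (measurable_itv `]0, 1[) f _ (measurable01 fc) _ gi.
have fb : [bounded f x | x in `]0, 1[%classic].
  exists C; split; first by rewrite num_real.
  by move=> x Cx t /=; rewrite in_itv/= => /fC /le_trans; apply; exact: ltW.
by move=> /(_ fb); apply: eq_integrable.
Qed.

(** Here [f] may be unbounded at 0 and 1. Its integral function and [F] have the same derivative
    inside and are continuous up to the ends, so the mean value theorem makes their difference
    constant. *)
Lemma FTC01 f F : integrable01 f ->
  (forall t, 0 < t < 1 -> {for t, continuous f}) ->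
  (forall t, 0 < t < 1 -> is_derive t 1 F (f t)) ->
  {within `[0, 1], continuous F} ->
  \int[mu]_(t in `[0, 1]) f t = F 1 - F 0.
Proof.
move=> fi fc dF cF; pose h := f \_ `]0, 1[.
have hi : mu.-integrable `[0, 1] (EFin \o h).
  apply: (@integrableS _ _ _ mu setT) => //.
  by rewrite /h -restrict_EFin; apply/(integrable_mkcond _ _).1 => //; exact: fi.
pose G x := \int[mu]_(t in `[0, x]) h t.
have cG : {within `[0, 1], continuous G}.
  exact: (parameterized_integral_continuous ler01 hi).
have dG t : t \in `]0, 1[ -> is_derive t 1 G (f t).
  move=> t01; have t01' := t01; rewrite in_itv/= in t01'; have [t0 t1] := andP t01'.
  have ch : {for t, continuous h}.
    have nt : \near t, f t = h t.
      near=> u; rewrite /h patchE ifT// inE/= in_itv/=.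
      near: u; exact: (@near_in_itvoo _ 0 1).
    have ht : h t = f t by rewrite /h patchE ifT// inE/= in_itv/=.
    by rewrite /prop_for /continuous_at ht; apply: cvg_trans (fc _ t01'); exact: near_eq_cvg.
  have [d1 d2] := continuous_FTC1_closed t1 hi t0 ch.
  apply: DeriveDef => //; rewrite -derive1E d2 /h patchE ifT//.
  by rewrite inE/= in_itv/= t0 t1.
have dH t : t \in `]0, 1[ -> is_derive t 1 (fun t => G t - F t) (cst 0 t).
  move=> t01; have := is_derive_fB (dG t t01) (dF t _); rewrite subrr; apply.
  by move: t01; rewrite in_itv.
have cH : {within `[0, 1], continuous (fun t => G t - F t)}.
  by move=> x; apply: continuousB; [exact: cG|exact: cF].
have [c _] := MVT_segment ler01 dH cH.
rewrite mul0r /G set_itv1 Rintegral_set1 => /eqP; rewrite subr_eq0 sub0r => /eqP GF.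
transitivity (\int[mu]_(t in `[0, 1]) h t); last by move: GF; lra.
rewrite int01_open//.
rewrite int01_open; last first.
  by apply: eq_integrable01 fi => t t01; rewrite /h patchE ifT// inE/= in_itv.
apply: eq_Rintegral => t; rewrite inE/= => t01; rewrite /h patchE ifT// inE.
Unshelve. all: by end_near. Qed.

(** On compact subintervals the integral of [f] is a difference of values of [F], hence at most
    [2 * C]; monotone convergence carries this bound to the whole interval. *)
Lemma integrable01_ge0 f F (C : R) :
  (forall t, 0 < t < 1 -> {for t, continuous f}) ->
  (forall t, 0 < t < 1 -> is_derive t 1 F (f t)) ->
  (forall t, 0 < t < 1 -> `|F t| <= C) ->
  (forall t, 0 < t < 1 -> 0 <= f t) ->
  integrable01 f.
Proof.
move=> fc dF FC f0; apply/integrableP; split.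
  by apply/measurable_EFinP; exact: measurable01.
(* The sequence 1 / (n + 3) stays below 1/2, so [[k n, 1 - k n]] is never degenerate. *)
have [k [k0 k1 kd kE]] : exists k : nat -> R, [/\ forall n, 0 < k n,
    forall n, k n < 2^-1, forall n, k n.+1 <= k n
    & forall e, 0 < e -> exists n, k n <= e].
  exists (fun n => n.+3%:R^-1); split=> [n|n|n|e e0].
  - by rewrite invr_gt0.
  - by rewrite ltf_pV2 ?posrE// ltr_nat.
  - by rewrite lef_pV2 ?posrE// ler_nat.
  - have [n /ltW nP] := ltr_add_invr e0; exists n.
    apply: le_trans nP; rewrite add0r lef_pV2 ?posrE// ler_nat.
    exact: leq_trans (leqnSn _) (leqnSn _).
pose A (n : nat) : set R := `[k n, 1 - k n]%classic.
have Asub n : A n `<=` `]0, 1[%classic.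
  move=> t; rewrite /A /= !in_itv/= => /andP[t0 t1].
  by have p := k0 n; apply/andP; split; lra.
have UA : \bigcup_n A n = `]0, 1[%classic.
  apply/seteqP; split=> [t [n _ /Asub]//|t]; rewrite /= in_itv/= => /andP[t0 t1].
  have m0 : 0 < Num.min t (1 - t) by rewrite lt_min t0 subr_gt0.
  have [n] := kE _ m0; rewrite le_min => /andP[n0 n1].
  by exists n => //; rewrite /A/= in_itv/= n0/=; lra.
have ndA : nondecreasing_seq A.
  apply/nondecreasing_seqP => n; rewrite subsetEset => t; rewrite /A/= !in_itv/=.
  by have := kd n => ? /andP[? ?]; apply/andP; split; lra.
have mA n : measurable (A n : set (measurableTypeR R)) by exact: measurable_itv.
have mf n : measurable_fun (A n : set (measurableTypeR R)) (abse \o (EFin \o f)).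
  apply: measurableT_comp => //; apply/measurable_EFinP.
  exact: measurable_funS (measurable_itv _) (Asub n) (measurable01 fc).
have H := ge0_nondecreasing_set_cvg_integral (mu := mu) ndA mA mf (fun _ _ _ => abse_ge0 _).
rewrite UA in H; rewrite -(cvg_lim _ H)//.
apply: (@le_lt_trans _ _ (2 * C)%:E); last by rewrite ltry.
apply: lime_le; first exact: cvgP H.
near=> n.
have p := k0 n; have p2 := k1 n.
have in01 t : t \in `[k n, 1 - k n] -> 0 < t < 1.
  by move=> tA; have := Asub n t tA; rewrite /= in_itv.
have dFF t : 0 < t < 1 -> {for t, continuous F}.
  by move=> t01; exact: is_derive_continuous (dF t t01).
have E0 : k n \in `[k n, 1 - k n].
  by rewrite in_itv/= lexx/=; lra.
have E1 : 1 - k n \in `[k n, 1 - k n].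
  by rewrite in_itv/= lexx andbT; lra.
have -> : (\int[mu]_(x in A n) (abse \o (EFin \o f)) x =
  (F (1 - k n))%:E - (F (k n))%:E)%E.
  rewrite -(@continuous_FTC2 _ f); [| lra | | split |].
  - by apply: eq_integral => t; rewrite inE => /Asub/=; rewrite in_itv/= => /f0 ?;
      rewrite ger0_norm.
  - by apply: continuous_in_subspaceT => t; rewrite inE => /in01 /fc.
  - move=> t /subset_itv_oo_cc /in01 t01.
    by have [] := dF t t01.
  - by apply: cvg_at_right_filter; apply: dFF; exact: in01.
  - by apply: cvg_at_left_filter; apply: dFF; exact: in01.
  - move=> t /subset_itv_oo_cc /in01 t01.
    by rewrite derive1E; have [] := dF t t01.
have := FC _ (in01 _ E0); have := FC _ (in01 _ E1).
rewrite -EFinB lee_fin !ler_norml => /andP[? ?] /andP[? ?]; lra.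
Unshelve. all: by end_near. Qed.

End UnitIntervalIntegral.

(** * Layer potentials of a segment *)

Section LinePotentials.
Context {R : realType}.
Implicit Types (a b e m n p q x : 'rV[R]_2) (s t al be : R).

Lemma is_derive_line (V : normedModType R) (f : V -> R) (x v : V) (l : R) :
  is_derive (0 : R) 1 (fun h : R => f (x + h *: v)) l -> is_derive x v f l.
Proof.
move=> [dg gl].
have E : (fun h : R => h^-1 *: (f (h *: v + x) - f x)) =
         (fun h : R => h^-1 *: (f (x + (h *: (1 : R) + 0) *: v) - f (x + (0 : R) *: v))).
  apply/funext => h; rewrite scale0r !addr0.
  by have -> : h *: (1 : R) = h by [rewrite /GRing.scale/= mulr1]; rewrite [x + _]addrC.
apply: DeriveDef; first by move: dg; rewrite /derivable /= -E.
by rewrite -gl /derive /= -E.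
Qed.

Lemma is_derive_coord p m t i : is_derive t 1 (fun s => (p + s *: m) 0 i) (m 0 i).
Proof.
rewrite (_ : (fun _ => _) = fun s => p 0 i + s * m 0 i).
  exact: is_derive_affine.
by apply/funext => s; rewrite !mxE.
Qed.

Lemma is_derive_dot_line p m e t :
  is_derive t 1 (fun s => dot (p + s *: m) e) (dot m e).
Proof.
have H := is_derive_fD (is_derive_fM (is_derive_coord p m t 0) (is_derive_cst (e 0 0) t 1))
                        (is_derive_fM (is_derive_coord p m t 1) (is_derive_cst (e 0 1) t 1)).
by apply: is_derive_eq H _; rewrite /dot /cst; ring.
Qed.

Lemma is_derive_cross_line p m e t :
  is_derive t 1 (fun s => cross (p + s *: m) e) (cross m e).
Proof.
have H := is_derive_fB (is_derive_fM (is_derive_coord p m t 0) (is_derive_cst (e 0 1) t 1))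
                        (is_derive_fM (is_derive_coord p m t 1) (is_derive_cst (e 0 0) t 1)).
by apply: is_derive_eq H _; rewrite /cross /cst; ring.
Qed.

Lemma is_derive_sqr_line p m t :
  is_derive t 1 (fun s => dot (p + s *: m) (p + s *: m)) (2 * dot (p + t *: m) m).
Proof.
have H := is_derive_fD (is_derive_fM (is_derive_coord p m t 0) (is_derive_coord p m t 0))
                        (is_derive_fM (is_derive_coord p m t 1) (is_derive_coord p m t 1)).
by apply: is_derive_eq H _; rewrite /dot; ring.
Qed.

Lemma dotDZl p m e s : dot (p + s *: m) e = dot p e + s * dot m e.
Proof. by rewrite /dot !mxE; ring. Qed.

Lemma crossDZl p m e s : cross (p + s *: m) e = cross p e + s * cross m e.
Proof. by rewrite /cross !mxE; ring. Qed.

Lemma xlnx_bound s : 0 < s -> s < 1 -> - 1 <= s * ln s <= 0.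
Proof.
move=> s0 s1.
have l1 : ln s^-1 <= s^-1 - 1.
  have := @le_ln1Dx _ (s^-1 - 1); rewrite [1 + _]addrCA subrr addr0; apply.
  by rewrite ltrBrDl addrN invr_gt0.
rewrite lnV ?posrE// in l1.
have l0 : ln s <= 0 by apply: ln_le0; exact: ltW.
have : - (s * ln s) <= 1.
  rewrite -mulrN; apply: (@le_trans _ _ (s * s^-1)); last by rewrite mulfV ?gt_eqF.
  by rewrite ler_pM2l//; lra.
have : 0 <= - (s * ln s) by rewrite -mulrN mulr_ge0 ?oppr_ge0// ltW.
lra.
Qed.

Lemma lineBline p q m s : (q + s *: m) - (p + s *: m) = q - p.
Proof. by rewrite opprD addrACA subrr addr0. Qed.

(* Up to the factor - (2 pi)^-1, the double-layer potential at the origin of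
   the affine density on the segment from p to q with end values al and be. *)
Definition dlpot p q al be : R :=
  al * angle p q + (be - al) / dot (q - p) (q - p) *
    (cross p (q - p) * (lnorm q - lnorm p) - dot p (q - p) * angle p q).

(* Up to an additive constant, the mean over the segment from p to q of ln |y|. *)
Definition slpot p q : R :=
  (dot q (q - p) * lnorm q - dot p (q - p) * lnorm p + cross p (q - p) * angle p q)
  / dot (q - p) (q - p).

(** The end terms carry the nodal values [al] and [be] and will cancel around a closed polygon; the
    rest sees the density only through its slope [be - al]. This is the integration by parts behind
    Maue's identity. *)
Lemma is_derive_dlpot p q m al be s : p != q -> visible (p + s *: m) (q + s *: m) ->
  let P := p + s *: m in let Q := q + s *: m in
  is_derive s 1 (fun s => dlpot (p + s *: m) (q + s *: m) al be)
   (be * (cross Q m / dot Q Q) - al * (cross P m / dot P P)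
    + (be - al) / dot (q - p) (q - p) *
      (cross m (q - p) * (lnorm Q - lnorm P) - dot m (q - p) * angle P Q)).
Proof.
move=> pq vis P Q; have /andP[P0 Q0] := visible_neq0 vis.
have DA := is_derive_angle_line vis.
have DL := is_derive_fB (is_derive_lnorm_line Q0) (is_derive_lnorm_line P0).
have DC := is_derive_cross_line p m (q - p) s.
have DD := is_derive_dot_line p m (q - p) s.
have H := is_derive_fD (is_derive_fZ al DA)
  (is_derive_fZ ((be - al) / dot (q - p) (q - p))
     (is_derive_fB (is_derive_fM DC DL) (is_derive_fM DD DA))).
rewrite (_ : (fun _ => _) = (fun s => al * angle (p + s *: m) (q + s *: m) +
  (be - al) / dot (q - p) (q - p) * (cross (p + s *: m) (q - p) *
   (lnorm (q + s *: m) - lnorm (p + s *: m))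
   - dot (p + s *: m) (q - p) * angle (p + s *: m) (q + s *: m)))); last first.
  by apply/funext => u; rewrite /dlpot lineBline.
apply: is_derive_eq H _.
have -> : q - p = Q - P by rewrite /P /Q lineBline.
have PQ : dot (Q - P) (Q - P) != 0.
  by rewrite dotxx_eq0 /P /Q lineBline subr_eq0 eq_sym.
rewrite -/P -/Q in P0 Q0 *; move: P0 Q0; rewrite -!dotxx_eq0.
move: (lnorm Q) (lnorm P) (angle P Q) => lQ lP A.
move: PQ; clear; move: P Q => p' q'; rewrite /dot /cross !mxE => H1 H2 H3.
by field; rewrite H1 H2 H3.
Qed.

(** The second alternative is motion along the line of the segment itself. The angle may jump there,
    but its factor [cross p (q - p)] is identically 0. It is used for an edge seen from its own
    points. *)
Lemma is_derive_slpot p q m s : p != q ->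
  let P := p + s *: m in let Q := q + s *: m in
  visible P Q \/ [/\ cross p (q - p) = 0, cross m (q - p) = 0, P != 0 & Q != 0] ->
  is_derive s 1 (fun s => slpot (p + s *: m) (q + s *: m))
   ((dot m (q - p) * (lnorm Q - lnorm P) + cross m (q - p) * angle P Q)
    / dot (q - p) (q - p)).
Proof.
move=> pq P Q vis.
have /andP[P0 Q0] : (P != 0) && (Q != 0).
  by case: vis => [/visible_neq0//|[_ _ -> ->]].
have DP := is_derive_fM (is_derive_dot_line p m (q - p) s) (is_derive_lnorm_line P0).
have DQ := is_derive_fM (is_derive_dot_line q m (q - p) s) (is_derive_lnorm_line Q0).
have DC : is_derive s 1 (fun s => cross (p + s *: m) (q - p) *
    angle (p + s *: m) (q + s *: m))
   (cross m (q - p) * angle P Q +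
    cross P (q - p) * (cross Q m / dot Q Q - cross P m / dot P P)).
  case: vis => [vis|[c0 c1 _ _]].
    have H := is_derive_fM (is_derive_cross_line p m (q - p) s) (is_derive_angle_line vis).
    by apply: is_derive_eq H _; rewrite addrC [angle _ _ * _]mulrC.
  have c u : cross (p + u *: m) (q - p) = 0.
    by rewrite crossDZl c0 c1 mulr0 addr0.
  rewrite (_ : (fun _ => _) = cst 0); last by apply/funext => u; rewrite c mul0r.
  by apply: is_derive_eq (is_derive_cst _ _ _) _; rewrite /P c c1 !mul0r addr0.
have H := is_derive_fZ (dot (q - p) (q - p))^-1 (is_derive_fD (is_derive_fB DQ DP) DC).
rewrite (_ : (fun _ => _) = (fun s => (dot (q - p) (q - p))^-1 *
   (dot (q + s *: m) (q - p) * lnorm (q + s *: m) -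
     dot (p + s *: m) (q - p) * lnorm (p + s *: m) +
     cross (p + s *: m) (q - p) * angle (p + s *: m) (q + s *: m)))); last first.
  by apply/funext => u; rewrite /slpot lineBline mulrC.
apply: is_derive_eq H _; rewrite -/P -/Q.
have -> : q - p = Q - P by rewrite /P /Q lineBline.
have PQ : dot (Q - P) (Q - P) != 0.
  by rewrite dotxx_eq0 /P /Q lineBline subr_eq0 eq_sym.
rewrite -/P -/Q in P0 Q0 *; move: P0 Q0; rewrite -!dotxx_eq0.
move: (lnorm Q) (lnorm P) (angle P Q) => lQ lP A .
move: PQ; clear; move: P Q => p' q'; rewrite /dot /cross !mxE => H1 H2 H3.
by field; rewrite H1 H2 H3.
Qed.

Lemma integrable01_ln : integrable01 (fun t : R => ln t).
Proof.
have H : integrable01 (fun t : R => - ln t).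
  apply: (@integrable01_ge0 _ _ (fun t => t - t * ln t) 2) => t /andP[t0 t1].
  - by apply: continuousN; exact: continuous_ln.
  - have L : is_derive t 1 (@ln R) t^-1 by exact: is_derive1_ln.
    have I := is_derive_id t (1 : R).
    apply: is_derive_eq (is_derive_fB I (is_derive_fM I L)) _.
    by rewrite mulfV ?gt_eqF//; ring.
  - by have := xlnx_bound t0 t1; rewrite ler_norml => ?; apply/andP; split; lra.
  - by rewrite oppr_ge0 ln_le0// ltW.
have := integrable01Z (-1) H.
by apply: eq_integrable01 => t _; rewrite mulrN mulN1r opprK.
Qed.

Lemma integrable01_ln1m : integrable01 (fun t : R => ln (1 - t)).
Proof.
have H : integrable01 (fun t : R => - ln (1 - t)).
  have D t : 0 < t < 1 -> is_derive t 1 (fun t : R => ln (1 - t)) (- (1 - t)^-1).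
    move=> /andP[t0 t1]; have p : 0 < 1 - t by lra.
    have H := is_derive_fln (is_derive_affine 1 (-1) t) _.
    have H2 : is_derive t 1 (fun t : R => ln (1 + t * -1)) (- (1 - t)^-1).
      apply: is_derive_eq (H _) _; first by rewrite mulrN1.
      by rewrite mulrN1 mulN1r.
    by rewrite (_ : (fun _ => _) = (fun t => ln (1 + t * -1)))//; apply/funext => u; rewrite mulrN1.
  apply: (@integrable01_ge0 _ _ (fun t => t + (1 - t) * ln (1 - t)) 2) => t t01.
  - by apply: continuousN; exact: is_derive_continuous (D t t01).
  - have I := is_derive_id t (1 : R).
    have H := is_derive_fD I (is_derive_fM (is_derive_fB (is_derive_cst (1 : R) t 1) I) (D t t01)).
    apply: is_derive_eq H _; have /andP[t0 t1] := t01.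
    have p : 1 - t != 0 by rewrite gt_eqF//; lra.
    by rewrite /cst mulrN mulfV//; ring.
  - have /andP[t0 t1] := t01; have p : 0 < 1 - t by lra.
    have p1 : 1 - t < 1 by lra.
    by have := xlnx_bound p p1; rewrite ler_norml => ?; apply/andP; split; lra.
  - by have /andP[t0 t1] := t01; rewrite oppr_ge0 ln_le0// lerBlDr lerDl ltW.
have := integrable01Z (-1) H.
by apply: eq_integrable01 => t _; rewrite mulrN mulN1r opprK.
Qed.

End LinePotentials.

(** * Integrability and continuity of the potentials along a line *)

Section LineIntegrability.
Context {R : realType}.
Implicit Types (a b e m n p q x : 'rV[R]_2) (s t al be : R).

Lemma cvg0_le (T : Type) (F : set_system T) (f g : T -> R) : Filter F ->
  (\forall t \near F, `|f t| <= g t) -> g t @[t --> F] --> 0 ->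
  f t @[t --> F] --> 0.
Proof.
move=> FF fg g0.
have fg' : \forall t \near F, - g t <= f t <= g t.
  by apply: filterS fg => t; rewrite ler_norml.
have ng0 : - g t @[t --> F] --> 0 by rewrite -oppr0; exact: cvgN.
refine (squeeze_cvgr fg' ng0 g0).
Qed.

Lemma cvg_fsum (T : Type) (F : set_system T) (I : Type) (s : seq I)
    (f : I -> T -> R) (l : I -> R) : Filter F ->
  (forall i, f i t @[t --> F] --> l i) ->
  \sum_(i <- s) f i t @[t --> F] --> \sum_(i <- s) l i.
Proof.
move=> FF fl; elim: s => [|i s IH].
  by rewrite big_nil; under eq_cvg do rewrite big_nil; exact: cvg_cst.
by rewrite big_cons; under eq_cvg do rewrite big_cons; exact: cvgD.
Qed.

Lemma lnormZ t p : 0 < t -> p != 0 -> lnorm (t *: p) = ln t + lnorm p.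
Proof.
move=> t0 p0; rewrite /lnorm enormZ gtr0_norm// lnM// posrE//.
by rewrite enorm_gt0.
Qed.

Lemma lnormN p : lnorm (- p) = lnorm p.
Proof. by rewrite /lnorm -scaleN1r enormZ normrN1 mul1r. Qed.

Lemma integrable01_continuous (f : R -> R) :
  (forall t, 0 <= t <= 1 -> {for t, continuous f}) -> integrable01 f.
Proof.
move=> fc; apply: (@integrableS _ _ _ lebesgue_measure `[0, 1]) => //.
  by move=> t /=; exact: subset_itv_oo_cc.
apply: continuous_compact_integrable; first exact: segment_compact.
by apply: continuous_in_subspaceT => t; rewrite inE/= in_itv/= => /fc.
Qed.

(** The line can meet the origin only at an end of the interval, and then the integrand is [ln t] or
    [ln (1 - t)] up to a constant; otherwise it is continuous on the closed interval. *)
Lemma integrable01_lnorm_line p m : m != 0 ->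
  (forall t, 0 < t < 1 -> p + t *: m != 0) ->
  integrable01 (fun t => lnorm (p + t *: m)).
Proof.
move=> m0 pm; have [p0|p0] := eqVneq p 0.
  have c : integrable01 (fun=> lnorm m).
    by apply: integrable01_continuous => t _; exact: cst_continuous.
  have := integrable01D integrable01_ln c.
  by apply: eq_integrable01 => t /andP[t0 t1]; rewrite p0 add0r lnormZ.
have [p1|p1] := eqVneq (p + 1 *: m) 0.
  have c : integrable01 (fun=> lnorm m).
    by apply: integrable01_continuous => t _; exact: cst_continuous.
  have := integrable01D integrable01_ln1m c.
  apply: eq_integrable01 => t /andP[t0 t1].
  have -> : p + t *: m = - ((1 - t) *: m).
    have -> : p = - m by apply/eqP; rewrite -subr_eq0 opprK -{1}[m]scale1r p1.
    by rewrite scalerBl scale1r opprB addrC.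
  by rewrite lnormN lnormZ// subr_gt0.
apply: integrable01_continuous => t /andP[].
rewrite le_eqVlt => /predU1P[<- _|t0].
  by apply: is_derive_continuous (is_derive_lnorm_line _); rewrite scale0r addr0.
rewrite le_eqVlt => /predU1P[->|t1].
  exact: is_derive_continuous (is_derive_lnorm_line p1).
by apply: is_derive_continuous (is_derive_lnorm_line (pm _ _)); rewrite t0.
Qed.

Lemma angle_collinear p q : cross p q = 0 -> angle p q = 0.
Proof. by rewrite /angle => ->; rewrite arg2_eq0. Qed.

Lemma integrable01_angle_line p q m :
  (forall t, 0 < t < 1 -> visible (p + t *: m) (q + t *: m)) \/
  (forall t, cross (p + t *: m) (q + t *: m) = 0) ->
  integrable01 (fun t => angle (p + t *: m) (q + t *: m)).
Proof.
case=> [vis|c0]; last first.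
  apply: (@eq_integrable01 _ (fun=> 0)).
    by move=> t _; rewrite angle_collinear.
  by apply: integrable01_continuous => t _; exact: cst_continuous.
apply: (@integrable01_bounded _ _ pi) => t t01.
  exact: is_derive_continuous (is_derive_angle_line (vis t t01)).
exact: normr_arg2_le.
Qed.

Lemma integrable01_affineM (c d : R) (f : R -> R) : integrable01 f ->
  integrable01 (fun t => (c + t * d) * f t).
Proof.
apply: (@integrable01M _ _ _ (`|c| + `|d|)) => t.
  by move=> _; exact: is_derive_continuous (is_derive_affine c d t).
move=> /andP[t0 t1]; apply: (le_trans (ler_normD _ _)); rewrite lerD2l normrM.
by rewrite ler_piMl// ger0_norm ltW.
Qed.

Lemma crossxBx p q : cross p (q - p) = cross p q.
Proof. by rewrite /cross !mxE; ring. Qed.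

Lemma integrable01_dlpot_line p q m al be : m != 0 ->
  (forall t, 0 < t < 1 -> p + t *: m != 0) ->
  (forall t, 0 < t < 1 -> q + t *: m != 0) ->
  (forall t, 0 < t < 1 -> visible (p + t *: m) (q + t *: m)) \/
  (forall t, cross (p + t *: m) (q + t *: m) = 0) ->
  integrable01 (fun t => dlpot (p + t *: m) (q + t *: m) al be).
Proof.
move=> m0 pm qm vis.
have iA := integrable01_angle_line vis.
have iL := integrable01B (integrable01_lnorm_line m0 qm) (integrable01_lnorm_line m0 pm).
have := integrable01D (integrable01Z al iA)
  (integrable01Z ((be - al) / dot (q - p) (q - p))
     (integrable01B (integrable01_affineM (cross p (q - p)) (cross m (q - p)) iL)
                    (integrable01_affineM (dot p (q - p)) (dot m (q - p)) iA))).
apply: eq_integrable01 => t _.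
by rewrite /dlpot lineBline -crossDZl -dotDZl.
Qed.

Lemma integrable01_slpot_derivative p q m : m != 0 ->
  (forall t, 0 < t < 1 -> p + t *: m != 0) ->
  (forall t, 0 < t < 1 -> q + t *: m != 0) ->
  (forall t, 0 < t < 1 -> visible (p + t *: m) (q + t *: m)) \/
  (forall t, cross (p + t *: m) (q + t *: m) = 0) ->
  integrable01 (fun t =>
   (dot m (q - p) * (lnorm (q + t *: m) - lnorm (p + t *: m))
    + cross m (q - p) * angle (p + t *: m) (q + t *: m)) / dot (q - p) (q - p)).
Proof.
move=> m0 pm qm vis.
have iA := integrable01_angle_line vis.
have iL := integrable01B (integrable01_lnorm_line m0 qm) (integrable01_lnorm_line m0 pm).
have := integrable01Z (dot (q - p) (q - p))^-1 (integrable01D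
  (integrable01Z (dot m (q - p)) iL) (integrable01Z (cross m (q - p)) iA)).
by apply: eq_integrable01 => t _; rewrite mulrC.
Qed.

(** With s = r^2 the product is 2 r (r ln r), and |r ln r| is at most 1. This gives an explicit
    modulus of continuity at 0. *)
Lemma xlnx_sqrt_bound s : 0 < s -> s < 1 -> `|s * ln s| <= 2 * Num.sqrt s.
Proof.
move=> s0 s1; have r0 : 0 < Num.sqrt s by rewrite sqrtr_gt0.
have r1 : Num.sqrt s < 1 by rewrite -[ltRHS]sqrtr1 ltr_sqrt.
have := xlnx_bound r0 r1.
have sE : s = Num.sqrt s ^+ 2 by rewrite sqr_sqrtr// ltW.
move: (Num.sqrt s) r0 r1 sE => r r0 r1 -> /andP[b0 b1].
rewrite lnXn// (_ : r ^+ 2 * _ = 2 * r * (r * ln r)); last by rewrite mulr2n; ring.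
rewrite normrM ger0_norm; last by rewrite mulr_ge0// ltW.
rewrite ler_piMr//; first by rewrite mulr_ge0// ltW.
by rewrite ler_norml; apply/andP; split; lra.
Qed.

(* The logarithmic singularity at a zero of the line is absorbed by the linear
   factor. *)
Lemma continuous_dot_lnorm_line p m e s :
  {for s, continuous (fun t => dot (p + t *: m) e * lnorm (p + t *: m))}.
Proof.
have [z|z] := eqVneq (p + s *: m) 0; last first.
  exact: is_derive_continuous
    (is_derive_fM (is_derive_dot_line p m e s) (is_derive_lnorm_line z)).
have pE t : p + t *: m = (t - s) *: m.
  by rewrite scalerBl -[p](addrK (s *: m)) z sub0r addrC.
have [m0|m0] := eqVneq m 0.
  rewrite (_ : (fun _ => _) = cst 0); first exact: cst_continuous.
  by apply/funext => t; rewrite pE m0 scaler0 /dot !mxE !mul0r addr0 mul0r.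
have em : 0 < enorm m by rewrite enorm_gt0.
rewrite /prop_for /continuous_at z.
have -> : dot 0 e * lnorm 0 = 0 by rewrite /dot !mxE !mul0r addr0 mul0r.
(* With u = |t - s| |m|, the product has absolute value |m . e| / |m| times |u ln u|, hence at most
   [K * Num.sqrt u]. *)
pose K := `|dot m e| / enorm m * 2.
pose g (t : R) := K * Num.sqrt (`|t - s| * enorm m).
have g0 : g t @[t --> s] --> 0.
  have -> : 0 = g s by rewrite /g subrr normr0 mul0r sqrtr0 mulr0.
  have ch : {for s, continuous (fun t => `|t - s| * enorm m)}.
    apply: cvgMl; apply: cvg_norm; apply: cvgB; [exact: cvg_id|exact: cvg_cst].
  exact: cvgMr (continuous_comp ch (@sqrt_continuous _ _)).
apply: cvg0_le g0.
near=> t.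
rewrite pE.
have [->|ts] := eqVneq t s.
  rewrite subrr scale0r /dot !mxE !mul0r addr0 mul0r normr0 /g.
  by rewrite mulr_ge0 ?sqrtr_ge0// /K mulr_ge0// divr_ge0// ltW.
have u0 : 0 < `|t - s| * enorm m by rewrite mulr_gt0// normr_gt0 subr_eq0.
have u1 : `|t - s| * enorm m < 1.
  rewrite -ltr_pdivlMr// div1r distrC.
  by near: t; apply: (@cvgr_dist_lt _ _ _ _ _ id s); [exact: cvg_id|rewrite invr_gt0].
have := xlnx_sqrt_bound u0 u1.
rewrite /lnorm enormZ /g /K.
have -> : dot ((t - s) *: m) e = (t - s) * dot m e.
  by rewrite -[_ *: m]add0r dotDZl /dot !mxE !mul0r addr0 add0r.
set u := `|t - s| * enorm m; move=> H.
have -> : `|(t - s) * dot m e * ln u| = `|dot m e| / enorm m * `|u * ln u|.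
  rewrite !normrM [`|(`|t - s|)|]normr_id (gtr0_norm em).
  by field; rewrite gt_eqF.
by rewrite -[leRHS]mulrA ler_wpM2l// divr_ge0// ltW.
Unshelve. all: by end_near. Qed.

(** Continuity persists even where the segment meets the origin: each logarithm is multiplied by a
    factor vanishing with its argument, and the angle is bounded and can be discontinuous only where
    its factor, the cross product, is 0. *)
Lemma continuous_slpot_line p q m s :
  {for s, continuous (fun t => slpot (p + t *: m) (q + t *: m))}.
Proof.
rewrite (_ : (fun _ => _) = (fun t =>
   (dot (q + t *: m) (q - p) * lnorm (q + t *: m)
     - dot (p + t *: m) (q - p) * lnorm (p + t *: m) +
     cross (p + t *: m) (q - p) * angle (p + t *: m) (q + t *: m))
   * (dot (q - p) (q - p))^-1)); last first.
  by apply/funext => u; rewrite /slpot lineBline.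
apply: cvgMl; apply: cvgD.
  by apply: cvgB; exact: continuous_dot_lnorm_line.
have dC := is_derive_cross_line p m (q - p) s.
have [c0|c0] := eqVneq (cross (p + s *: m) (q - p)) 0; last first.
  have vis : visible (p + s *: m) (q + s *: m).
    by rewrite /visible -crossxBx lineBline c0 orbT.
  exact: is_derive_continuous (is_derive_fM dC (is_derive_angle_line vis)).
rewrite c0 mul0r; have nc := is_derive_continuous dC.
have gc0 : `|cross (p + t *: m) (q - p)| * pi @[t --> s] --> 0.
  have -> : 0 = `|cross (p + s *: m) (q - p)| * pi by rewrite c0 normr0 mul0r.
  by apply: cvgMl; apply: cvg_norm.
apply: cvg0_le gc0.
by apply: nearW => t; rewrite normrM ler_wpM2l//; exact: normr_arg2_le.
Qed.

End LineIntegrability.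

(** * The double-layer kernel on one edge and its jump *)

Section EdgeKernel.
Context {R : realType}.
Implicit Types (a b e m n p q x y : 'rV[R]_2) (s t al be : R).

Lemma derive_green x y n : x != y ->
  'D_n (fun z => green (x - z)) y = (2 * pi)^-1 * (dot (x - y) n / dot (x - y) (x - y)).
Proof.
move=> xy.
have xy0 : (x - y) + 0 *: (- n) != 0 by rewrite scale0r addr0 subr_eq0.
have H := is_derive_fZ (- (2 * pi)^-1) (is_derive_lnorm_line xy0).
suff D : is_derive y n (fun z => green (x - z))
    ((2 * pi)^-1 * (dot (x - y) n / dot (x - y) (x - y))) by case: D.
apply: is_derive_line.
rewrite (_ : (fun _ => _) = (fun s => - (2 * pi)^-1 * lnorm (x - y + s *: - n))).
  apply: is_derive_eq H _; rewrite scale0r addr0 mulNr -mulrN -mulNr.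
  by congr (_ * (_ / _)); rewrite /dot !mxE; ring.
by apply/funext => s; rewrite /green /lnorm scalerN opprD addrA.
Qed.

Lemma right_normal_dot a b p :
  dot p (right_normal a b) = - (enorm (b - a))^-1 * cross (b - a) p.
Proof. by rewrite /dot /right_normal /perp /cross !mxE/=; ring. Qed.

Lemma right_normal_cross a b p :
  cross (right_normal a b) p = (enorm (b - a))^-1 * dot (b - a) p.
Proof. by rewrite /dot /right_normal /perp /cross !mxE/=; ring. Qed.

Lemma sub_segment_point a b x t : segment_point a b t - x = (a - x) + t *: (b - a).
Proof. by rewrite /segment_point addrAC. Qed.

Lemma subrBB a b x : (b - x) - (a - x) = b - a.
Proof. by rewrite opprB addrA subrK. Qed.

Lemma visible_segment a b x : ~ segment a b x -> visible (a - x) (b - x).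
Proof.
apply: contra_notT; rewrite /visible negb_or negbK -leNgt => /andP[d0 /eqP c0].
suff [t t01 w0] : exists2 t, 0 <= t <= 1 & (a - x) + t *: (b - a) = 0.
  exists t; first by rewrite /= in_itv.
  by apply/eqP; rewrite -subr_eq0 sub_segment_point w0.
have qE : b - x = (a - x) + (b - a) by rewrite [RHS]addrC addrA subrK.
move: d0 c0; rewrite qE; move: (a - x) (b - a) => p e {qE} d0 c0.
have d0' : dot p p + dot p e <= 0 by move: d0; rewrite /dot !mxE; lra.
have d3 := dotxx_ge0 p.
have [e0|e0] := eqVneq e 0.
  exists 0; rewrite ?lexx ?ler01// e0 scaler0 addr0; apply/eqP.
  by rewrite -dotxx_eq0 eq_le d3 andbT; move: d0'; rewrite e0 /dot !mxE; lra.
have E0 : 0 < dot e e by rewrite dotxx_gt0.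
(* The foot of the perpendicular from the origin to the line; it lies on the segment and, the
   vectors being collinear, is the origin itself. *)
pose t := - dot p e / dot e e.
have c1 : cross p e = 0 by rewrite -c0 /cross !mxE; ring.
have d1 : 0 <= dot (p + e) (p + e) by exact: dotxx_ge0.
have d2 : dot (p + e) (p + e) = (dot p p + dot p e) + dot p e + dot e e.
  by rewrite /dot !mxE; ring.
exists t.
  apply/andP; split; first by apply: divr_ge0; [lra|exact: ltW].
  by rewrite /t ler_pdivrMr// mul1r; lra.
apply/eqP; rewrite -dotxx_eq0.
have := dot_cross_sqr (p + t *: e) e.
have tE : t * dot e e = - dot p e by rewrite /t divfK// gt_eqF.
rewrite dotDZl crossDZl c1 (_ : cross e e = 0); last by rewrite /cross; ring.
rewrite tE subrr mulr0 addr0 expr0n/= addr0 => /esym/eqP.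
by rewrite mulf_eq0 (gt_eqF E0) orbF.
Qed.

(** The point [x] may lie inside the edge. The kernel then vanishes at every other edge point, and
    [dlpot] is 0 as well because the angle of collinear vectors is 0, so the formula also covers the
    direct value. *)
Lemma double_layer_edge a b x al be : a != b -> x != a -> x != b ->
  enorm (b - a) * \int[lebesgue_measure]_(t in `[0, 1])
    ('D_(right_normal a b) (fun y => green (x - y)) (segment_point a b t)
     * ((1 - t) * al + t * be))
  = - (2 * pi)^-1 * dlpot (a - x) (b - x) al be.
Proof.
move=> ab xa xb; pose p := a - x; pose e := b - a.
have e0 : e != 0 by rewrite subr_eq0 eq_sym.
have E0 : 0 < dot e e by rewrite dotxx_gt0.
have le0 : 0 < enorm e by rewrite enorm_gt0.
have p0 : p != 0 by rewrite subr_eq0 eq_sym.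
have qE : b - x = p + e by rewrite /p /e [RHS]addrC addrA subrK.
have q0 : p + e != 0 by rewrite -qE subr_eq0 eq_sym.
have kE t : p + t *: e != 0 ->
    'D_(right_normal a b) (fun y => green (x - y)) (segment_point a b t) =
    - (2 * pi)^-1 * (enorm e)^-1 * (cross p e / dot (p + t *: e) (p + t *: e)).
  move=> w0; have := sub_segment_point a b x t; rewrite -/p -/e => wE.
  rewrite derive_green; last first.
    by rewrite eq_sym -subr_eq0 wE.
  have -> : x - segment_point a b t = - (p + t *: e) by rewrite -wE opprB.
  rewrite right_normal_dot -/e.
  have -> : cross e (- (p + t *: e)) = cross p e by rewrite /cross !mxE; ring.
  have -> : dot (- (p + t *: e)) (- (p + t *: e)) = dot (p + t *: e) (p + t *: e).
    by rewrite /dot !mxE; ring.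
  ring.
have [c0|vis] := boolP (visible p (p + e)); last first.
  move: vis; rewrite /visible negb_or negbK -leNgt => /andP[_ /eqP c0].
  have c1 : cross p e = 0 by rewrite -c0 /cross !mxE; ring.
  rewrite qE /dlpot angle_collinear// (_ : p + e - p = e) ?c1; last by rewrite addrC addKr.
  rewrite !mul0r !mulr0 subrr mulr0 addr0 mulr0.
  (* The parameter of [x] on the edge, the only place where the kernel is singular; it is removed as
     a null set. *)
  pose t0 := - dot p e / dot e e.
  have wN t : t != t0 -> p + t *: e != 0.
    apply: contraNneq => w0; rewrite /t0 -[X in _ == X / _]addr0 eq_sym.
    have := congr1 (fun v => dot v e) w0; rewrite /= dotDZl.
    have -> : dot 0 e = 0 by rewrite /dot !mxE !mul0r addr0.
    by move=> /eqP; rewrite addr0 addrC addr_eq0 => /eqP <-; rewrite mulfK// gt_eqF.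
  apply/eqP; rewrite mulf_eq0 gt_eqF//=; apply/eqP.
  rewrite /Rintegral -(@integral_setD1 _ _ t0).
  - rewrite integral0_eq// => t [_ /= /eqP tt].
    by rewrite kE ?wN// c1 mul0r mulr0 mul0r.
  - by apply: measurableD => //; exact: measurable_set1.
  - apply: (eq_measurable_fun (cst 0%E)) => // t; rewrite inE => -[_ /= /eqP tt].
    by rewrite kE ?wN// c1 mul0r mulr0 mul0r.
have vt t : 0 <= t <= 1 -> visible p (p + t *: e).
  move=> /andP[t0 t1]; rewrite /visible.
  have cE : cross p (p + t *: e) = t * cross p (p + e) by rewrite /cross !mxE; ring.
  have dE : dot p (p + t *: e) = (1 - t) * dot p p + t * dot p (p + e).
    by rewrite /dot !mxE; ring.
  have pp : 0 < dot p p by rewrite dotxx_gt0.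
  have [->|tn] := eqVneq t 0; first by rewrite scale0r addr0 pp.
  case/orP: c0 => [d0|c0]; last by rewrite cE mulf_neq0 ?orbT.
  have h1 : 0 <= (1 - t) * dot p p by rewrite mulr_ge0 ?subr_ge0// ltW.
  have h2 : 0 < t * dot p (p + e) by rewrite mulr_gt0// lt0r tn.
  by apply/orP; left; rewrite dE; lra.
have wt t : 0 <= t <= 1 -> p + t *: e != 0 by move=> /vt /visible_neq0 /andP[].
pose f t : R := - (2 * pi)^-1 * (cross p e / dot (p + t *: e) (p + t *: e) * (al + t * (be - al))).
(* The density is split as a constant plus a multiple of (p + t e) . e: the constant integrates to
   the angle, the other part to the logarithm. The term [t *: 0] keeps the first vector fixed in the
   form required by [is_derive_angle_line]. *)
pose F t : R := - (2 * pi)^-1 * ((al - (be - al) / dot e e * dot p e) *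
  angle (p + t *: 0) (p + t *: e)
    + (be - al) / dot e e * cross p e * lnorm (p + t *: e)).
have dF t : 0 <= t <= 1 -> is_derive t 1 F (f t).
  move=> t01; have vis : visible (p + t *: 0) (p + t *: e) by rewrite scaler0 addr0 vt.
  have H := is_derive_fZ (- (2 * pi)^-1)
    (is_derive_fD (is_derive_fZ (al - (be - al) / dot e e * dot p e) (is_derive_angle_line vis))
      (is_derive_fZ ((be - al) / dot e e * cross p e) (is_derive_lnorm_line (wt t t01)))).
  apply: is_derive_eq H _; rewrite /f; congr (_ * _).
  have -> : cross (p + t *: 0) 0 = 0 by rewrite /cross !mxE; ring.
  have := wt t t01; rewrite -dotxx_eq0; set W := dot (p + t *: e) (p + t *: e) => W0.
  rewrite mul0r subr0 crossDZl dotDZl (_ : cross e e = 0) ?mulr0 ?addr0;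
    last by rewrite /cross; ring.
  by field; rewrite W0 gt_eqF.
have cf t : 0 <= t <= 1 -> {for t, continuous f}.
  move=> t01; have := wt t t01; rewrite -dotxx_eq0 => W0.
  exact: is_derive_continuous (is_derive_fZ _ (is_derive_fM
    (is_derive_fM (is_derive_cst (cross p e) t 1) (is_derive_fV (is_derive_sqr_line p e t) W0))
    (is_derive_affine al (be - al) t))).
have fi : integrable01 f by exact: integrable01_continuous.
have oc t : 0 < t < 1 -> 0 <= t <= 1 by move=> /andP[/ltW -> /ltW ->].
have lei := integrable01Z (enorm e)^-1 fi.
rewrite -/e -(@eq_int01 _ (fun t => (enorm e)^-1 * f t)); last 2 first.
- move=> t /oc/wt w0; rewrite kE// /f; ring.
- by [].
have cF : {within `[0, 1], continuous F}.
  apply: continuous_in_subspaceT => t; rewrite inE/= in_itv/= => /dF D.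
  exact: is_derive_continuous D.
have FTC := FTC01 fi (fun t h => cf t (oc t h)) (fun t h => dF t (oc t h)) cF.
rewrite int01Z// mulrA mulfV ?gt_eqF// mul1r FTC.
rewrite /F !scaler0 !scale0r !addr0 scale1r qE /dlpot (_ : p + e - p = e);
  last by rewrite addrC addKr.
have -> : angle p p = 0 by rewrite angle_collinear// /cross; ring.
ring.
Qed.

Lemma near_visible p q m s : visible (p + s *: m) (q + s *: m) ->
  \forall u \near s, visible (p + u *: m) (q + u *: m).
Proof.
move=> vis.
have Dd := is_derive_continuous (is_derive_fD
  (is_derive_fM (is_derive_coord p m s 0) (is_derive_coord q m s 0))
  (is_derive_fM (is_derive_coord p m s 1) (is_derive_coord q m s 1))).
have Dc := is_derive_continuous (is_derive_fB
  (is_derive_fM (is_derive_coord p m s 0) (is_derive_coord q m s 1))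
  (is_derive_fM (is_derive_coord p m s 1) (is_derive_coord q m s 0))).
case/orP: vis => [d0|c0].
  near=> u; apply/orP; left; near: u.
  exact: (cvgr_gt _ Dd).
near=> u; apply/orP; right; near: u.
exact: (cvgr_neq0 _ Dc).
Unshelve. all: by end_near. Qed.

(** From the left, the product of the two vectors tends to the negative real axis from above.
    Reflection gives arg(X + iY) = pi - arg(-X + iY), and the right side is continuous at Y = 0. *)
Lemma angle_jump a b m t : 0 < t < 1 -> 0 < cross (b - a) m ->
  let x := segment_point a b t in
  angle (a - x + s *: (- m)) (b - x + s *: (- m)) @[s --> 0^'+] --> (pi : R).
Proof.
move=> /andP[t0 t1] c0 x; pose p := a - x; pose q := b - x.
pose e := b - a.
have pE : p = - t *: e by rewrite /p /x /segment_point opprD addNKr scaleNr.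
have qE : q = (1 - t) *: e.
  by rewrite /q /x /segment_point scalerBl scale1r opprD addrA.
have e0 : e != 0.
  by apply: contraTneq c0; rewrite -/e => ->; rewrite /cross !mxE !mul0r subrr ltxx.
have E0 : 0 < dot e e by rewrite dotxx_gt0.
pose X s := dot (p + s *: (- m)) (q + s *: (- m)).
pose Y s := cross (p + s *: (- m)) (q + s *: (- m)).
have DX s := is_derive_fD
  (is_derive_fM (is_derive_coord p (- m) s 0) (is_derive_coord q (- m) s 0))
  (is_derive_fM (is_derive_coord p (- m) s 1) (is_derive_coord q (- m) s 1)).
have DY s := is_derive_fB
  (is_derive_fM (is_derive_coord p (- m) s 0) (is_derive_coord q (- m) s 1))
  (is_derive_fM (is_derive_coord p (- m) s 1) (is_derive_coord q (- m) s 0)).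
have X0 : X 0 < 0.
  rewrite /X !scale0r !addr0 pE qE.
  have -> : dot (- t *: e) ((1 - t) *: e) = - (t * (1 - t) * dot e e).
    by rewrite /dot !mxE; ring.
  by rewrite oppr_lt0 !mulr_gt0// subr_gt0.
have YE s : Y s = s * cross e m.
  by rewrite /Y pE qE /cross !mxE; ring.
have cA : {for 0, continuous (fun s => arg2 (- X s) (Y s))}.
  apply: is_derive_continuous (is_derive_arg2 (is_derive_fN (DX 0)) (DY 0) _).
  by rewrite -/(X 0) oppr_gt0 X0.
have lim : pi - arg2 (- X s) (Y s) @[s --> 0^'+] --> (pi : R).
  suff H : pi - arg2 (- X s) (Y s) @[s --> 0^'+] --> pi - arg2 (- X 0) (Y 0).
    by move: H; rewrite YE mul0r arg2_eq0 subr0.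
  by apply: cvgB; [exact: cvg_cst|apply: cvg_at_right_filter].
apply: cvg_trans lim; apply: near_eq_cvg; near=> s.
have s0 : 0 < s by near: s; exact: nbhs_right_gt.
have Xs : X s < 0.
  near: s; have cX := cvg_at_right_filter (is_derive_continuous (DX 0)).
  exact: (cvgr_lt _ cX).
have Ys : 0 < Y s by rewrite YE mulr_gt0.
rewrite -[RHS]/(arg2 (X s) (Y s)) [RHS]arg2_neg//.
by rewrite /arg2 sqrrN.
Unshelve. all: by end_near. Qed.

End EdgeKernel.

(** * The discrete Dirichlet-to-Neumann matrix of a polygonal boundary *)

Lemma uniq_flatten_mem (T : eqType) (ss : seq (seq T)) (c : seq T) :
  uniq (flatten ss) -> c \in ss -> uniq c.
Proof.
elim: ss => //= c' ss IH; rewrite cat_uniq => /and3P[cU _ sU].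
by rewrite inE => /predU1P[->//|]; exact: IH.
Qed.

Section PolygonDtN.
Context {R : realType} {n : nat}.
Variables (P : 'I_n -> 'rV[R]_2) (bd : seq (seq 'I_n)).
Hypothesis bdU : uniq (flatten bd).

Local Notation NX := (size (bverts bd)).
Local Notation NY := (size (bedges bd)).
Local Notation A e := (P (@esrc n bd e)).
Local Notation B e := (P (@edst n bd e)).

Lemma edge_mem (e : 'I_NY) :
  exists2 c, c \in bd & esrc e \in c /\ edst e = next c (esrc e).
Proof.
have : tnth (in_tuple (bedges bd)) e \in bedges bd by rewrite mem_tnth.
case/flattenP => s /mapP[c cbd ->] /mapP[v vc E].
by exists c => //; rewrite /esrc /edst E.
Qed.

Lemma sum_edges (F : 'I_n -> 'I_n -> R) :
  \sum_(e < NY) F (esrc e) (edst e) = \sum_(c <- bd) \sum_(v <- c) F v (next c v).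
Proof.
transitivity (\sum_(uv <- bedges bd) F uv.1 uv.2).
  by rewrite [RHS]big_tnth.
by rewrite big_flatten big_map; apply: eq_bigr => c _; rewrite big_map.
Qed.

(** On each polygon [next] permutes the vertices, so every vertex is a source once and a destination
    once. *)
Lemma sum_edges_telescope (F : 'I_n -> R) :
  \sum_(e < NY) (F (edst e) - F (esrc e)) = 0.
Proof.
rewrite (sum_edges (fun u v => F v - F u)) big_seq big1// => c cbd.
have cU := uniq_flatten_mem bdU cbd.
rewrite sumrB; apply/eqP; rewrite subr_eq0; apply/eqP.
rewrite -(big_map (next c) xpredT F); apply: perm_big.
apply: uniq_perm => //.
  by rewrite map_inj_in_uniq// => u v _ _; exact: (can_inj (prev_next cU)).
move=> v; apply/mapP/idP => [[u uc ->]|vc]; first by rewrite mem_next.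
by exists (prev c v); rewrite ?mem_prev ?next_prev.
Qed.

Lemma esrc_bverts (e : 'I_NY) : esrc e \in bverts bd.
Proof. by have [c cbd [vc _]] := edge_mem e; apply/flattenP; exists c. Qed.

Lemma edst_bverts (e : 'I_NY) : edst e \in bverts bd.
Proof.
have [c cbd [vc ->]] := edge_mem e; apply/flattenP; exists c => //.
by rewrite mem_next.
Qed.

Lemma sum_bvert (v : 'I_n) : v \in bverts bd ->
  \sum_(j < NX) (v == bvert j)%:R = 1 :> R.
Proof.
move=> vb; transitivity (\sum_(u <- bverts bd) (v == u)%:R : R).
  by rewrite [RHS]big_tnth.
rewrite (bigD1_seq v)//= eqxx big1 ?addr0// => u uv.
by rewrite eq_sym (negbTE uv).
Qed.

Lemma sum_hat (e : 'I_NY) (t : R) : \sum_(j < NX) hat j e t = 1.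
Proof.
rewrite /hat big_split/= -!mulr_sumr !sum_bvert ?esrc_bverts ?edst_bverts//.
by rewrite !mulr1 subrK.
Qed.

Lemma restriction_mx_const :
  restriction_mx bd *m (const_mx 1 : 'cV[R]_n) = const_mx 1.
Proof.
apply/matrixP => a j; rewrite !mxE (bigD1 (bvert a))//= big1.
  by rewrite !mxE eqxx mul1r addr0.
by move=> u uv; rewrite !mxE eq_sym (negbTE uv) mul0r.
Qed.

Hypothesis edge_neq : forall e : 'I_NY, A e != B e.
Hypothesis edge_disj : forall (e e' : 'I_NY) (t : R), e != e' -> 0 < t < 1 ->
  ~ segment (A e') (B e') (epoint P e t).

Lemma sub_epoint (a : 'rV[R]_2) (e : 'I_NY) (t : R) :
  a - epoint P e t = (a - A e) + t *: (- (B e - A e)).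
Proof. by rewrite /epoint /segment_point opprD addrA scalerN. Qed.

Lemma epoint_visible (e e' : 'I_NY) (t : R) : e != e' -> 0 < t < 1 ->
  visible (A e' - epoint P e t) (B e' - epoint P e t).
Proof. by move=> ee t01; apply: visible_segment; exact: edge_disj. Qed.

Lemma epoint_neq (e e' : 'I_NY) (t : R) : 0 < t < 1 ->
  A e' - epoint P e t != 0 /\ B e' - epoint P e t != 0.
Proof.
move=> t01; have [<-|ee] := eqVneq e e'; last first.
  by have /visible_neq0/andP[] := epoint_visible ee t01.
have /andP[t0 t1] := t01.
have e0 : B e - A e != 0 by rewrite subr_eq0 eq_sym edge_neq.
split; rewrite sub_epoint.
  by rewrite subrr add0r scalerN oppr_eq0 scaler_eq0 (gt_eqF t0).
rewrite scalerN -{1}[B e - A e]scale1r -scalerBl scaler_eq0 negb_or e0 andbT.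
by rewrite subr_eq0 gt_eqF.
Qed.

Lemma epoint_collinear (e : 'I_NY) (t : R) :
  cross (A e - epoint P e t) (B e - epoint P e t) = 0.
Proof. by rewrite /cross !sub_epoint !mxE; ring. Qed.

Lemma epoint_visible_or_collinear (e e' : 'I_NY) :
  (forall t, 0 < t < 1 ->
    visible (A e' - A e + t *: - (B e - A e)) (B e' - A e + t *: - (B e - A e))) \/
  (forall t, cross (A e' - A e + t *: - (B e - A e)) (B e' - A e + t *: - (B e - A e)) = 0).
Proof.
have [<-|ee] := eqVneq e e'.
  by right=> t; rewrite -!sub_epoint epoint_collinear.
by left=> t t01; rewrite -!sub_epoint epoint_visible.
Qed.

Lemma Aline_neq (e e' : 'I_NY) (t : R) : 0 < t < 1 ->
  A e' - A e + t *: - (B e - A e) != 0.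
Proof. by move=> t01; rewrite -sub_epoint; case: (epoint_neq e e' t01). Qed.

Lemma Bline_neq (e e' : 'I_NY) (t : R) : 0 < t < 1 ->
  B e' - A e + t *: - (B e - A e) != 0.
Proof. by move=> t01; rewrite -sub_epoint; case: (epoint_neq e e' t01). Qed.

Lemma dir_neq0 (e : 'I_NY) : - (B e - A e) != 0.
Proof. by rewrite oppr_eq0 subr_eq0 eq_sym edge_neq. Qed.

(** The values of [hat j] at the two ends of [e], to be used as [al] and [be] in [dlpot]. *)
Definition ind_src (j : 'I_NX) (e : 'I_NY) : R := (esrc e == bvert j)%:R.
Definition ind_dst (j : 'I_NX) (e : 'I_NY) : R := (edst e == bvert j)%:R.

Lemma double_layer_hat (j : 'I_NX) (x : 'rV[R]_2) :
  (forall e, A e - x != 0 /\ B e - x != 0) ->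
  double_layer P (hat j) x =
  - (2 * pi)^-1 * \sum_(e < NY) dlpot (A e - x) (B e - x) (ind_src j e) (ind_dst j e).
Proof.
move=> xv; rewrite mulr_sumr; apply: eq_bigr => e _.
have [xa xb] := xv e; rewrite !subr_eq0 in xa xb.
by rewrite -double_layer_edge// 1?eq_sym.
Qed.

(** Up to the factor [- (2 * pi)^-1], the double-layer potential of the density 1. At a point inside
    an edge, that edge contributes 0. *)
Definition angle_sum (x : 'rV[R]_2) : R := \sum_(e < NY) angle (A e - x) (B e - x).

Lemma sum_dlpot (x : 'rV[R]_2) :
  \sum_(j < NX) \sum_(e < NY) dlpot (A e - x) (B e - x) (ind_src j e) (ind_dst j e)
  = angle_sum x.
Proof.
rewrite exchange_big; apply: eq_bigr => e _.
rewrite /dlpot big_split/= -mulr_suml sum_bvert ?esrc_bverts// mul1r.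
rewrite -!mulr_suml sumrB !sum_bvert ?esrc_bverts ?edst_bverts//.
by rewrite subrr !mul0r addr0.
Qed.

Lemma pairing_chi (i : 'I_NY) (g : bfun bd) :
  pairing P (chi (R := R) i) g = elen P i * \int[lebesgue_measure]_(t in `[0, 1]) g i t.
Proof.
rewrite /pairing /bint (bigD1 i)//= big1 ?addr0.
  by congr (_ * _); apply: eq_Rintegral => t _; rewrite /chi eqxx mul1r.
move=> e ei; rewrite (_ : \int[_]_(t in _) _ = 0) ?mulr0//.
rewrite -[RHS](int01_cst 0); apply: eq_Rintegral => t _.
by rewrite /chi (negbTE ei) mul0r.
Qed.

Lemma Kmx_row_sum (kappa : R) (i : 'I_NY) :
  (forall t, 0 < t < 1 -> angle_sum (epoint (bd := bd) P i t) = kappa) ->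
  \sum_(j < NX) Kmx P bd i j = - (2 * pi)^-1 * kappa * elen P i.
Proof.
move=> kE.
have hi (j : 'I_NX) : integrable01 (fun t => on_bd P (double_layer P (hat j)) i t).
  have := integrable01Z (- (2 * pi)^-1) (integrable01_sum (index_enum 'I_NY) (fun e =>
    integrable01_dlpot_line (ind_src j e) (ind_dst j e) (dir_neq0 i)
     (Aline_neq i e) (Bline_neq i e) (epoint_visible_or_collinear i e))).
  apply: eq_integrable01 => // t t01.
  rewrite /on_bd double_layer_hat; last by move=> e; exact: epoint_neq.
  by congr (_ * _); apply: eq_bigr => e _; rewrite !sub_epoint.
transitivity (elen P i * \int[lebesgue_measure]_(t in `[0, 1])
   (\sum_(j < NX) on_bd P (double_layer P (hat j)) i t)).
  rewrite int01_sum// mulr_sumr; apply: eq_bigr => j _.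
  by rewrite mxE pairing_chi.
rewrite mulrC -(@eq_int01 _ (fun=> - (2 * pi)^-1 * kappa)) ?int01_cst//; last first.
  by apply: integrable01_continuous => t _; exact: cst_continuous.
move=> t t01; rewrite -(kE t t01) -sum_dlpot mulr_sumr.
by apply: eq_bigr => j _; rewrite /on_bd double_layer_hat// => e; exact: epoint_neq.
Qed.

Lemma Mmx_row_sum (i : 'I_NY) : \sum_(j < NX) Mmx P bd i j = elen P i.
Proof.
transitivity (elen P i * \int[lebesgue_measure]_(t in `[0, 1]) (\sum_(j < NX) hat j i t)).
  rewrite int01_sum; first by rewrite mulr_sumr; apply: eq_bigr => j _; rewrite mxE pairing_chi.
  move=> j; apply: integrable01_continuous => t _.
  rewrite (_ : hat j i = (fun t => ind_src j i + t * (ind_dst j i - ind_src j i))).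
    exact: is_derive_continuous (is_derive_affine _ _ t).
  by apply/funext => s; rewrite /hat -/(ind_src _ _) -/(ind_dst _ _); ring.
rewrite -[RHS]mulr1 -[X in _ = _ * X]int01_cst; congr (_ * _).
by apply: eq_Rintegral => t _; rewrite sum_hat.
Qed.

(** The length of [e] times the tangential derivative of [hat j] on it, i.e. a rescaled entry of the
    matrix [D] in Maue's identity. *)
Definition ind_diff (j : 'I_NX) (e : 'I_NY) : R := ind_dst j e - ind_src j e.

Lemma near_epoint_visible (e : 'I_NY) (t : R) (m : 'rV[R]_2) :
  0 < t < 1 -> cross (B e - A e) m != 0 ->
  \forall s \near (0 : R), s != 0 -> forall e',
    visible (A e' - epoint P e t + s *: m) (B e' - epoint P e t + s *: m).
Proof.
move=> t01 c0.
have ne1 e' : \forall s \near (0 : R), e != e' ->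
    visible (A e' - epoint P e t + s *: m) (B e' - epoint P e t + s *: m).
  have [<-|ee] := eqVneq e e'; first by exists 1 => //= s _.
  have v0 : visible (A e' - epoint P e t + (0 : R) *: m) (B e' - epoint P e t + (0 : R) *: m).
    by rewrite scale0r !addr0 epoint_visible.
  by apply: filterS (near_visible v0) => s + _; exact.
have ne := filter_forall (nbhs_filter (0 : R)) ne1.
apply: filterS ne => s vs s0 e'; have [<-|] := eqVneq e e'; last exact: vs.
apply/orP; right; rewrite !sub_epoint.
rewrite (_ : cross _ _ = - s * cross (B e - A e) m); first by rewrite mulf_neq0 ?oppr_eq0.
by rewrite /cross !mxE; ring.
Qed.

(* Maue's identity on the open edge [e]: the hypersingular operator is the
   tangential derivative of the single layer of the tangential derivative. *)
Lemma hypersingular_hat (j : 'I_NX) (e : 'I_NY) (t : R) : 0 < t < 1 ->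
  hypersingular P (hat j) e t =
  (2 * pi)^-1 * (elen P e)^-1 * \sum_(e' < NY) ind_diff j e' *
   ((dot (- (B e - A e)) (B e' - A e') *
       (lnorm (B e' - epoint P e t) - lnorm (A e' - epoint P e t))
     + cross (- (B e - A e)) (B e' - A e') *
       angle (A e' - epoint P e t) (B e' - epoint P e t))
    / dot (B e' - A e') (B e' - A e')).
Proof.
move=> t01; set x := epoint P e t; pose nu := enormal P e.
have E0 : B e - A e != 0 by rewrite subr_eq0 eq_sym edge_neq.
have lE : 0 < elen P e by rewrite enorm_gt0.
have nuc : cross (B e - A e) (- nu) != 0.
  rewrite (_ : cross _ _ = cross nu (B e - A e)); last by rewrite /cross !mxE; ring.
  by rewrite right_normal_cross -sqr_enorm expr2 mulKf gt_eqF.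
have vis := near_epoint_visible t01 nuc; rewrite -/x in vis.
pose D s e' := (cross (- nu) (B e' - A e') *
     (lnorm (B e' - x + s *: - nu) - lnorm (A e' - x + s *: - nu))
   - dot (- nu) (B e' - A e') * angle (A e' - x + s *: - nu) (B e' - x + s *: - nu))
   / dot (B e' - A e') (B e' - A e').
have derE : \forall d \near 0^'+,
    'D_nu (double_layer P (hat j)) (x - d *: nu) =
    - (2 * pi)^-1 * \sum_e' ind_diff j e' * D (- d) e'.
  have [r /= r0 rv] := vis.
  near=> d.
  have d0 : 0 < d by near: d; exact: nbhs_right_gt.
  have dr : d < r by near: d; exact: nbhs_right_lt.
  (* The radius keeps [s] strictly between [- r] and 0, hence near the edge point but off the
     edge. *)
  have vd s : `|s + d| < Num.min d (r - d) -> forall e',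
      visible (A e' - x + s *: - nu) (B e' - x + s *: - nu).
    rewrite lt_min ltr_norml => /andP[/andP[s1 s2] /ltr_normlP[s3 s4]].
    apply: rv; rewrite /= ?sub0r ?normrN.
      by apply/ltr_normlP; split; lra.
    by apply/negP => /eqP s0; lra.
  have vd0 e' : visible (A e' - x + (- d) *: - nu) (B e' - x + (- d) *: - nu).
    by apply: vd; rewrite addNr normr0 lt_min d0 subr_gt0.
  suff H : is_derive (x - d *: nu) nu (double_layer P (hat j))
      (- (2 * pi)^-1 * \sum_e' ind_diff j e' * D (- d) e') by case: H.
  apply: is_derive_line.
  have H := is_derive_fZ (- (2 * pi)^-1) (is_derive_fsum (index_enum 'I_NY)
    (fun e' => is_derive_dlpot (ind_src j e') (ind_dst j e') (_ : A e' - x != B e' - x) (vd0 e'))).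
  have ABx e' : A e' - x != B e' - x by rewrite (inj_eq (addIr _)) edge_neq.
  have {H} := H ABx.
  set dl := \sum_(e' <- _) _.
  have -> : dl = \sum_e' ind_diff j e' * D (- d) e'.
    (* The end terms at a vertex [v], weighted by the value of [hat j] there. Continuity of the
       density makes this a function of the vertex alone, so the terms cancel around each
       polygon. *)
    pose q v := (v == bvert j)%:R * (cross (P v - x + - d *: - nu) (- nu)
       / dot (P v - x + - d *: - nu) (P v - x + - d *: - nu)) : R.
    have := sum_edges_telescope q; rewrite /dl => q0.
    transitivity (\sum_(e' < NY) (q (edst e') - q (esrc e')) + \sum_e' ind_diff j e' * D (- d) e').
      rewrite -big_split/=; apply: eq_bigr => e' _; rewrite subrBB /D /ind_diff /q
          -/(ind_src _ _) -/(ind_dst _ _).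
      by congr (_ + _); rewrite -mulrA; congr (_ * _); rewrite mulrC.
    by rewrite q0 add0r.
  move=> H.
  have H1 : is_derive (0 : R) 1 (fun h : R => - d + h * 1) 1 by exact: is_derive_affine.
  set G := (fun s => - (2 * pi)^-1 * _) in H.
  have H2 : is_derive (- d + 0 * 1) 1 G (- (2 * pi)^-1 * \sum_e' ind_diff j e' * D (- d) e').
    by rewrite mul0r addr0.
  have H3 := @is_derive1_comp _ G (fun h : R => - d + h * 1) 0 _ _ H2 H1.
  rewrite mulr1 in H3.
  apply: (near_eq_is_derive _ H3).
  have m0 : 0 < Num.min d (r - d) by rewrite lt_min d0 subr_gt0.
  near=> h.
  have hm : `|h| < Num.min d (r - d).
    by near: h; exact: (@nbhs0_lt _ R^o _ m0).
  have E' v : P v - (x - d *: nu + h *: nu) = P v - x + (- d + h * 1) *: - nu.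
    by apply/rowP => i; rewrite !mxE; ring.
  rewrite double_layer_hat; last first.
    move=> e'; rewrite !E'; apply/andP/visible_neq0/vd.
    by rewrite mulr1 addrAC addNr add0r.
  by rewrite /= /G; congr (_ * _); apply: eq_bigr => e' _; rewrite !E'.
have cD e' : {for 0, continuous (D^~ e')}.
  apply: cvgMl; apply: cvgB.
    apply: cvgMr; have [a0 b0] := epoint_neq e e' t01.
    apply: cvgB; apply: is_derive_continuous (is_derive_lnorm_line _);
    by rewrite scale0r addr0.
  have [<-|ee] := eqVneq e e'.
    (* On the edge itself the angle jumps at [s = 0], but its factor vanishes because [nu] is normal
       to the edge. *)
    have -> : dot (- nu) (B e - A e) = 0.
      have := right_normal_dot (A e) (B e) (B e - A e); rewrite -/nu /cross /dot !mxE; lra.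
    rewrite mul0r (_ : (fun _ => _) = cst 0); first exact: cvg_cst.
    by apply/funext => s; rewrite mul0r.
  apply: cvgMr; have v0 : visible (A e' - x + (0 : R) *: - nu) (B e' - x + (0 : R) *: - nu).
    by rewrite scale0r !addr0 epoint_visible.
  exact: is_derive_continuous (is_derive_angle_line v0).
have lim0 : 'D_nu (double_layer P (hat j)) (x - d *: nu) @[d --> 0^'+] -->
    - (2 * pi)^-1 * \sum_e' ind_diff j e' * D 0 e'.
  have L : - (2 * pi)^-1 * \sum_e' ind_diff j e' * D (- d) e' @[d --> 0^'+] -->
    - (2 * pi)^-1 * \sum_e' ind_diff j e' * D 0 e'.
    apply: cvgMr; apply: cvg_fsum => e'; apply: cvgMr.
    apply: cvg_at_right_filter.
    have cN : {for (0 : R), continuous (fun d : R => - d)}.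
      by apply: is_derive_continuous (is_derive_fN (is_derive_id _ _)).
    have cD' : {for - (0 : R), continuous (D^~ e')} by rewrite oppr0; exact: cD.
    have := continuous_comp cN cD'; rewrite /prop_for /continuous_at /= oppr0.
    exact.
  apply: cvg_trans L; apply: near_eq_cvg; apply: filterS derE => d ->.
  by [].
rewrite /hypersingular -/x -/nu (cvg_lim _ lim0)// mulNr opprK -mulrA; congr (_ * _).
rewrite mulr_sumr; apply: eq_bigr => e' _; rewrite [RHS]mulrCA; congr (_ * _).
rewrite /D !scale0r !addr0 [RHS]mulrA; congr (_ / _).
(* A quarter turn: cross and dot products with the normal become dot and cross products with the
   tangent, and the normal derivative takes the form of the derivative of [slpot] along the edge. *)
have -> : cross (- nu) (B e' - A e') = - cross nu (B e' - A e') by rewrite /cross !mxE; ring.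
have -> : dot (- nu) (B e' - A e') = - dot (B e' - A e') nu by rewrite /dot !mxE; ring.
rewrite right_normal_dot right_normal_cross -/(elen P e) /dot /cross !mxE; ring.
Unshelve. all: by end_near. Qed.

Lemma integrable01_hypersingular (j : 'I_NX) (e : 'I_NY) :
  integrable01 (fun t => hypersingular P (hat j) e t).
Proof.
have := integrable01Z ((2 * pi)^-1 * (elen P e)^-1)
  (integrable01_sum (index_enum 'I_NY) (fun e' => integrable01Z (ind_diff j e')
    (integrable01_slpot_derivative (dir_neq0 e) (Aline_neq e e') (Bline_neq e e')
       (epoint_visible_or_collinear e e')))).
apply: eq_integrable01 => t t01; rewrite hypersingular_hat//; congr (_ * _).
by apply: eq_bigr => e' _; rewrite subrBB !sub_epoint.
Qed.

(** Seen from the moving edge point, [slpot] is a primitive of each summand, continuous up to the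
    vertices. The result depends on [e] only through its two ends, ready for telescoping. *)
Lemma int01_hypersingular (j : 'I_NX) (e : 'I_NY) :
  elen P e * \int[lebesgue_measure]_(t in `[0, 1]) hypersingular P (hat j) e t =
  (2 * pi)^-1 * \sum_(e' < NY) ind_diff j e' *
    (slpot (A e' - B e) (B e' - B e) - slpot (A e' - A e) (B e' - A e)).
Proof.
have lE : 0 < elen P e by rewrite enorm_gt0 -oppr_eq0 dir_neq0.
have I e' := integrable01_slpot_derivative (dir_neq0 e) (Aline_neq e e') (Bline_neq e e')
       (epoint_visible_or_collinear e e').
pose f e' := fun t => (dot (- (B e - A e)) (B e' - A e - (A e' - A e)) *
       (lnorm (B e' - A e + t *: - (B e - A e)) - lnorm (A e' - A e + t *: - (B e - A e)))
     + cross (- (B e - A e)) (B e' - A e - (A e' - A e)) *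
       angle (A e' - A e + t *: - (B e - A e)) (B e' - A e + t *: - (B e - A e)))
    / dot (B e' - A e - (A e' - A e)) (B e' - A e - (A e' - A e)).
have FT e' : \int[lebesgue_measure]_(t in `[0, 1]) f e' t =
    slpot (A e' - B e) (B e' - B e) - slpot (A e' - A e) (B e' - A e).
  have AB : A e' - A e != B e' - A e by rewrite (inj_eq (addIr _)) edge_neq.
  have cases t : 0 < t < 1 ->
      visible (A e' - A e + t *: - (B e - A e)) (B e' - A e + t *: - (B e - A e)) \/
      [/\ cross (A e' - A e) (B e' - A e - (A e' - A e)) = 0,
        cross (- (B e - A e)) (B e' - A e - (A e' - A e)) = 0,
        A e' - A e + t *: - (B e - A e) != 0 & B e' - A e + t *: - (B e - A e) != 0].
    move=> t01; have [<-|ee] := eqVneq e e'; last first.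
      by left; rewrite -!sub_epoint epoint_visible.
    right; split; [by rewrite /cross !mxE; ring|by rewrite /cross !mxE; ring
      |exact: Aline_neq|exact: Bline_neq].
  have der (t : R) : 0 < t < 1 -> is_derive t 1 (fun t => slpot (A e' - A e + t *: - (B e - A e))
      (B e' - A e + t *: - (B e - A e))) (f e' t).
    by move=> t01; exact: is_derive_slpot AB (cases t t01).
  have cf t : 0 < t < 1 -> {for t, continuous (f e')}.
    move=> t01; apply: cvgMl; apply: cvgD.
      apply: cvgMr; apply: cvgB; apply: is_derive_continuous (is_derive_lnorm_line _).
        exact: Bline_neq.
      exact: Aline_neq.
    case: (cases t t01) => [vis|[_ c0 _ _]].
      by apply: cvgMr; exact: is_derive_continuous (is_derive_angle_line vis).
    rewrite c0 mul0r (_ : (fun _ => _) = cst 0); first exact: cvg_cst.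
    by apply/funext => u; rewrite mul0r.
  have cF : {within `[0, 1], continuous (fun t => slpot (A e' - A e + t *: - (B e - A e))
      (B e' - A e + t *: - (B e - A e)))}.
    by apply: continuous_subspaceT => t; exact: continuous_slpot_line.
  rewrite (FTC01 (I e') cf der cF) !scale1r !scale0r !addr0.
  have S v : P v - A e - (B e - A e) = P v - B e by rewrite opprB addrA subrK.
  by rewrite !S.
rewrite -(@eq_int01 _ (fun t => (2 * pi)^-1 * (elen P e)^-1 *
    \sum_(e' < NY) ind_diff j e' * f e' t)); last 2 first.
- move=> t t01; rewrite hypersingular_hat//; congr (_ * _).
  by apply: eq_bigr => e' _; rewrite /f subrBB !sub_epoint.
- apply: integrable01Z; apply: integrable01_sum => e'; apply: integrable01Z.
  exact: I.
rewrite int01Z; last first.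
  by apply: integrable01_sum => e'; apply: integrable01Z; exact: I.
rewrite int01_sum; last by move=> e'; apply: integrable01Z; exact: I.
rewrite mulrA [elen P e * _]mulrC mulfVK ?gt_eqF//; congr (_ * _).
by apply: eq_bigr => e' _; rewrite int01Z ?FT//; exact: I.
Qed.

Lemma Wmx_col_sum (j : 'I_NX) : \sum_(i < NX) Wmx P bd i j = 0.
Proof.
have hE i e t : hat i e t = ind_src i e + t * (ind_dst i e - ind_src i e) :> R.
  by rewrite /hat -/(ind_src _ _) -/(ind_dst _ _); ring.
have iW i e : integrable01 (fun t => hat i e t * hypersingular P (hat j) e t).
  have := integrable01_affineM (ind_src i e) (ind_dst i e - ind_src i e)
    (integrable01_hypersingular j e).
  by apply: eq_integrable01 => t _; rewrite hE.
transitivity (\sum_(e < NY) elen P e *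
    \int[lebesgue_measure]_(t in `[0, 1]) hypersingular P (hat j) e t).
  transitivity (\sum_(i < NX) \sum_(e < NY) elen P e *
    \int[lebesgue_measure]_(t in `[0, 1]) (hat i e t * hypersingular P (hat j) e t)).
    by apply: eq_bigr => i _; rewrite mxE.
  rewrite exchange_big; apply: eq_bigr => e _ /=.
  rewrite -mulr_sumr -int01_sum//; congr (_ * _).
  by apply: eq_Rintegral => t _; rewrite -mulr_suml sum_hat mul1r.
under eq_bigr do rewrite int01_hypersingular.
rewrite -mulr_sumr exchange_big big1 ?mulr0// => e' _.
rewrite -mulr_sumr.
(* For a fixed source edge [e'] the end values telescope over the test edges [e]. *)
by rewrite (sum_edges_telescope (fun v => slpot (A e' - P v) (B e' - P v))) mulr0.
Qed.

Lemma const1_Wmx : (const_mx 1 : 'cV[R]_NX)^T *m Wmx P bd = 0.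
Proof.
apply/matrixP => i j; rewrite !mxE -[RHS](Wmx_col_sum j).
by apply: eq_bigr => k _; rewrite !mxE mul1r.
Qed.

Lemma Jmx_const1 (kappa : R) :
  (forall i t, 0 < t < 1 -> angle_sum (epoint (bd := bd) P i t) = kappa) ->
  Jmx P bd *m const_mx 1 = (2^-1 - (2 * pi)^-1 * kappa) *: ell P bd.
Proof.
move=> kE; apply/matrixP => i j; rewrite !mxE.
have JE k : Jmx P bd i k = 2^-1 * Mmx P bd i k + Kmx P bd i k.
  by rewrite /Jmx [LHS]mxE [X in X + _]mxE.
under eq_bigr do rewrite [const_mx _ _ _]mxE mulr1 JE.
rewrite big_split/= -mulr_sumr Mmx_row_sum (Kmx_row_sum (kE i)).
under [in RHS]eq_bigr do rewrite [const_mx _ _ _]mxE mulr1.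
by rewrite Mmx_row_sum; ring.
Qed.

Lemma const1_dtn_bounded :
  (forall i t, 0 < t < 1 -> angle_sum (epoint (bd := bd) P i t) = pi) ->
  (const_mx 1 : 'cV[R]_NX)^T *m dtn_bounded P bd = 0.
Proof.
move=> kE; have pi0 : pi != 0 :> R by rewrite gt_eqF ?pi_gt0.
have J0 : Jmx P bd *m const_mx 1 = 0 :> 'cV[R]_NY.
  rewrite (Jmx_const1 kE) (_ : _ - _ = 0) ?scale0r//.
  by rewrite invfM mulfVK// subrr.
rewrite /dtn_bounded mulmxDr const1_Wmx add0r !mulmxA -trmx_mul J0.
by rewrite trmx0 !mul0mx.
Qed.

(** The default 0 of [xget] satisfies this trivially. Otherwise the constraint of the saddle-point
    system is read off column by column, with basis vectors as right-hand sides. *)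
Lemma ell_Cmx : (ell P bd)^T *m Cmx P bd = 0.
Proof.
rewrite /Cmx; case: xgetP => [C _ CP|_]; last by rewrite mulmx0.
apply/matrixP => i j; rewrite [RHS]mxE.
have [c /(_ (C *m delta_mx j 0) c)[_ H]] := CP (delta_mx j 0).
have [_] := H (conj erefl erefl).
by rewrite mulmxA -colE => /matrixP/(_ i 0); rewrite !mxE.
Qed.

Lemma const1_dtn_unbounded (kappa : R) :
  (forall i t, 0 < t < 1 -> angle_sum (epoint (bd := bd) P i t) = kappa) ->
  (const_mx 1 : 'cV[R]_NX)^T *m dtn_unbounded P bd = 0.
Proof.
move=> kE; rewrite /dtn_unbounded mulmxDr const1_Wmx add0r !mulmxA -trmx_mul.
by rewrite (Jmx_const1 kE) linearZ/= -scalemxAl ell_Cmx scaler0 mul0mx.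
Qed.

End PolygonDtN.

(** * Total angle subtended by a closed polygonal boundary *)

Section Winding.
Context {R : realType} {n : nat}.
Variables (P : 'I_n -> 'rV[R]_2) (bd : seq (seq 'I_n)).
Hypothesis bdU : uniq (flatten bd).

Local Notation NY := (size (bedges bd)).
Local Notation A e := (P (@esrc n bd e)).
Local Notation B e := (P (@edst n bd e)).

Hypothesis edge_neq : forall e : 'I_NY, A e != B e.
Hypothesis edge_disj : forall (e e' : 'I_NY) (t : R), e != e' -> 0 < t < 1 ->
  ~ segment (A e') (B e') (epoint P e t).

Definition bdset : set 'rV[R]_2 := [set x | exists e : 'I_NY, segment (A e) (B e) x].

Lemma sub_line (a x m : 'rV[R]_2) (s : R) : a - (x + s *: m) = (a - x) + s *: - m.
Proof. by rewrite opprD addrA scalerN. Qed.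

(** Off the boundary every edge angle is differentiable, and the derivatives, being differences of
    vertex terms, sum to 0 around each polygon. *)
Lemma angle_sum_segment (x m : 'rV[R]_2) :
  (forall s, 0 <= s <= 1 -> ~ bdset (x + s *: m)) ->
  angle_sum P bd (x + m) = angle_sum P bd x.
Proof.
move=> H; pose f s := \sum_(e < NY) angle (A e - x + s *: - m) (B e - x + s *: - m).
have fE s : f s = angle_sum P bd (x + s *: m).
  by apply: eq_bigr => e _; rewrite !sub_line.
have df (s : R) : 0 <= s <= 1 -> is_derive s 1 f (cst 0 s).
  move=> s01.
  have vis e : visible (A e - x + s *: - m) (B e - x + s *: - m).
    rewrite -!sub_line; apply: visible_segment => S.
    by apply: (H s s01); exists e.
  have D := is_derive_fsum (index_enum 'I_NY) (fun e => is_derive_angle_line (vis e)).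
  apply: is_derive_eq D _.
  pose q v := cross (P v - x + s *: - m) (- m) / dot (P v - x + s *: - m) (P v - x + s *: - m).
  exact: (sum_edges_telescope bdU q).
have cf : {within `[0, 1], continuous f}.
  apply: continuous_in_subspaceT => s; rewrite inE/= in_itv/= => /df D.
  exact: is_derive_continuous D.
have df' (s : R) : s \in `]0, 1[ -> is_derive s 1 f (cst 0 s).
  by rewrite in_itv/= => /andP[s0 s1]; apply: df; rewrite !ltW.
have [c _ /eqP] := MVT_segment ler01 df' cf.
by rewrite mul0r subr_eq0 !fE scale1r scale0r addr0 => /eqP.
Qed.

Lemma angle_scale (u : R) (p q : 'rV[R]_2) : 0 < u ->
  angle (u *: p) (u *: q) = angle p q.
Proof.
move=> u0; rewrite /angle /arg2.
have -> : dot (u *: p) (u *: q) = u ^+ 2 * dot p q by rewrite /dot !mxE; ring.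
have -> : cross (u *: p) (u *: q) = u ^+ 2 * cross p q by rewrite /cross !mxE; ring.
have u2 : 0 < u ^+ 2 by rewrite exprn_gt0.
rewrite !exprMn -mulrDr sqrtrM ?sqr_ge0// sqrtr_sqr ger0_norm ?sqr_ge0//.
by rewrite -mulrDr -mulf_div divff ?gt_eqF// mul1r.
Qed.

(** The angle is constant along the ray. With u = 1 / s and a rescaling by u, the limit at infinity
    becomes continuity at u = 0, where both ends of every edge shrink to the vector [- m] and the
    angle is 0. *)
Lemma angle_sum_ray (x m : 'rV[R]_2) : m != 0 ->
  (forall s, 0 < s -> ~ bdset (x + s *: m)) ->
  forall s, 0 < s -> angle_sum P bd (x + s *: m) = 0.
Proof.
move=> m0 H.
have cst_ray s s' : 0 < s -> 0 < s' ->
    angle_sum P bd (x + s *: m) = angle_sum P bd (x + s' *: m).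
  move=> s0 s'0.
  have -> : x + s *: m = (x + s' *: m) + (s - s') *: m.
    by apply/rowP => i; rewrite !mxE; ring.
  apply: angle_sum_segment => u /andP[u0 u1].
  rewrite scalerA -addrA -scalerDl; apply: H.
  have -> : s' + u * (s - s') = (1 - u) * s' + u * s by ring.
  have [->|un] := eqVneq u 0; first by rewrite subr0 mul1r mul0r addr0.
  have h1 : 0 <= (1 - u) * s' by rewrite mulr_ge0 ?subr_ge0// ltW.
  have h2 : 0 < u * s by rewrite mulr_gt0// lt0r un.
  lra.
move=> s s0; pose f u := \sum_(e < NY) angle (- m + u *: (A e - x)) (- m + u *: (B e - x)).
have fE u : 0 < u -> f u = angle_sum P bd (x + s *: m).
  move=> u0; rewrite (cst_ray s u^-1)// ?invr_gt0//; apply: eq_bigr => e _.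
  have E v : - m + u *: (P v - x) = u *: (P v - (x + u^-1 *: m)).
    by apply/rowP => i; rewrite !mxE; field; rewrite gt_eqF.
  by rewrite !E angle_scale.
have cf : {for 0, continuous f}.
  have vis e : visible (- m + (0 : R) *: (A e - x)) (- m + (0 : R) *: (B e - x)).
    rewrite /visible !scale0r !addr0 dotxx_gt0.
    by rewrite oppr_eq0 m0.
  exact: is_derive_continuous (is_derive_fsum (index_enum 'I_NY)
    (fun e => is_derive_angle_line (vis e))).
have f0 : f 0 = 0.
  by apply: big1 => e _; rewrite !scale0r angle_collinear// /cross; ring.
have L1 : f u @[u --> 0^'+] --> (0 : R).
  by have := cvg_at_right_filter cf; rewrite f0.
have L2 : f u @[u --> 0^'+] --> angle_sum P bd (x + s *: m).
  apply: (@cvg_trans _ (angle_sum P bd (x + s *: m) @[u --> (0 : R)^'+])); last exact: cvg_cst.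
  apply: near_eq_cvg; near=> u; rewrite fE//.
exact: (cvg_unique _ L2 L1).
Unshelve. all: by end_near. Qed.

Lemma angleC (p q : 'rV[R]_2) : angle q p = - angle p q.
Proof.
rewrite /angle -arg2N; congr (arg2 _ _); first by rewrite /dot; ring.
by rewrite /cross; ring.
Qed.

Lemma angle_jump_right (a b m : 'rV[R]_2) (t : R) : 0 < t < 1 -> cross (b - a) m < 0 ->
  let x := segment_point a b t in
  angle (a - x + s *: (- m)) (b - x + s *: (- m)) @[s --> 0^'+] --> (- pi : R).
Proof.
move=> /andP[t0 t1] c0 x.
have xE : x = segment_point b a (1 - t).
  by apply/rowP => i; rewrite /x /segment_point !mxE; ring.
have c1 : 0 < cross (a - b) m by move: c0; rewrite /cross !mxE; lra.
have t01 : 0 < 1 - t < 1 by apply/andP; split; lra.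
have H : - angle (b - x + s *: - m) (a - x + s *: - m) @[s --> 0^'+] --> (- pi : R).
  by apply: cvgN; rewrite xE; exact: angle_jump.
apply: cvg_trans H; apply: near_eq_cvg; apply: nearW => s.
by rewrite -angleC.
Qed.

(** Only the edge through the point jumps: its own angle counts as 0 there and tends to [k], while
    all other angles are continuous. *)
Lemma angle_sum_jump (e : 'I_NY) (t : R) (m : 'rV[R]_2) (k : R) : 0 < t < 1 ->
  angle (A e - epoint P e t + s *: (- m)) (B e - epoint P e t + s *: (- m))
    @[s --> 0^'+] --> k ->
  angle_sum P bd (epoint P e t + s *: m) @[s --> 0^'+] --> angle_sum P bd (epoint P e t) + k.
Proof.
move=> t01 jump.
pose l e' := angle (A e' - epoint P e t) (B e' - epoint P e t) + (e == e')%:R * k.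
have -> : angle_sum P bd (epoint P e t) + k = \sum_e' l e'.
  rewrite big_split/=; congr (_ + _); rewrite (bigD1 e)//= eqxx mul1r big1 ?addr0// => e' ee.
  by rewrite eq_sym (negbTE ee) mul0r.
have H e' : angle (A e' - epoint P e t + s *: - m) (B e' - epoint P e t + s *: - m)
    @[s --> 0^'+] --> l e'.
  rewrite /l; have [<-|ee] := eqVneq e e'.
    by rewrite angle_collinear ?epoint_collinear// add0r mul1r.
  rewrite mul0r addr0; apply: cvg_at_right_filter.
  have v0 : visible (A e' - epoint P e t + (0 : R) *: - m) (B e' - epoint P e t + (0 : R) *: - m).
    by rewrite scale0r !addr0 epoint_visible.
  have := is_derive_continuous (is_derive_angle_line v0).
  by rewrite /prop_for /continuous_at scale0r !addr0.
apply: cvg_trans (cvg_fsum (s := index_enum 'I_NY) _ H).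
apply: near_eq_cvg; apply: nearW => s; apply: eq_bigr => e' _.
by rewrite !(sub_line _ (epoint P e t)).
Qed.

Lemma enormal_left (e : 'I_NY) : 0 < cross (B e - A e) (- enormal P e).
Proof.
have E0 : B e - A e != 0 by rewrite subr_eq0 eq_sym edge_neq.
rewrite (_ : cross _ _ = cross (enormal P e) (B e - A e)); last by rewrite /cross !mxE; ring.
by rewrite right_normal_cross mulr_gt0 ?invr_gt0 ?enorm_gt0 ?dotxx_gt0.
Qed.

Variable D : set 'rV[R]_2.
Hypothesis Dopen : open D.
Hypothesis Dconn : connected D.
Hypothesis Dbd : bdset = closure D `\` D.
Hypothesis Dleft : forall (e : 'I_NY) (t : R), 0 < t < 1 ->
  \forall d \near 0^'+, D (epoint P e t - d *: enormal P e).

Lemma line_continuous (x m : 'rV[R]_2) : continuous (fun s : R => x + s *: m).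
Proof.
move=> s; apply: cvgD; first exact: cvg_cst.
by apply: cvgZr_tmp; exact: cvg_id.
Qed.

Lemma D_notin_bdset x : D x -> ~ bdset x.
Proof. by move=> Dx; rewrite Dbd => -[]. Qed.

(** Inside the segment, [D] is relatively open, and relatively closed because [closure D] adds only
    boundary points, which the segment avoids. Connectedness concludes. *)
Lemma segment_stays_inside (x m : 'rV[R]_2) : D x ->
  (forall s, 0 <= s <= 1 -> ~ bdset (x + s *: m)) -> D (x + m).
Proof.
move=> Dx H; pose L := [set x + s *: m | s in `[(0 : R), 1]].
have Lc : connected L.
  apply: connected_continuous_connected.
    by apply/connected_intervalP; exact: interval_is_interval.
  by apply: continuous_subspaceT; exact: line_continuous.
have Lx : L x by exists 0; rewrite /= ?in_itv/= ?lexx ?ler01// scale0r addr0.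
have E : L `&` D = L.
  apply: Lc.
  - by exists x.
  - by exists D.
  - exists (closure D); first exact: closed_closure.
    apply/seteqP; split=> y [Ly Dy]; split => //; first exact: subset_closure.
    apply: contrapT => nDy; case: Ly => s /=; rewrite in_itv/= => s01 yE.
    by apply: (H s s01); rewrite yE Dbd.
have : L (x + m) by exists 1; rewrite /= ?in_itv/= ?lexx ?ler01// scale1r.
by rewrite -E => -[].
Qed.

Lemma angle_sum_locally_constant x : D x ->
  \forall y \near x, D y /\ angle_sum P bd y = angle_sum P bd x.
Proof.
move=> Dx; have /nbhs_ballP[r /= r0 rD] : nbhs x D by exact: open_nbhs_nbhs.
apply/nbhs_ballP; exists r => //= y xy; split; first exact: rD.
have -> : y = x + (y - x) by rewrite addrC subrK.
apply: angle_sum_segment => s /andP[s0 s1]; apply: D_notin_bdset; apply: rD.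
move: xy; rewrite -!ball_normE/= => xy.
rewrite opprD addrA subrr sub0r normrN normrZ ger0_norm//.
apply: le_lt_trans xy; rewrite distrC.
by rewrite ler_piMl.
Qed.

Lemma angle_sum_constant x y : D x -> D y -> angle_sum P bd x = angle_sum P bd y.
Proof.
move=> Dx Dy; pose C := [set z | D z /\ angle_sum P bd z = angle_sum P bd y].
have Copen : open C.
  rewrite openE => z [Dz zE]; apply: filterS (angle_sum_locally_constant Dz).
  by move=> w [Dw wE]; split=> //; rewrite wE.
pose C' := [set z | D z /\ angle_sum P bd z <> angle_sum P bd y].
have C'open : open C'.
  rewrite openE => z [Dz zE]; apply: filterS (angle_sum_locally_constant Dz).
  by move=> w [Dw wE]; split=> //; rewrite wE.
have E : C = D.
  apply: Dconn.
  - by exists y.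
  - by exists C => //; apply/seteqP; split=> z; [move=> Cz; split=> //; case: Cz|case].
  - exists (~` C'); first exact: open_closedC.
    apply/seteqP; split=> z.
      by move=> [Dz zE]; split=> // -[_].
    by move=> [Dz /not_andP[//|/contrapT]].
by have : C x by [rewrite E]; case.
Qed.

Lemma angle_sum_epoint (e : 'I_NY) (t : R) x : 0 < t < 1 -> D x ->
  angle_sum P bd (epoint P e t) + pi = angle_sum P bd x.
Proof.
move=> t01 Dx; have J := angle_sum_jump t01 (angle_jump t01 (enormal_left e)).
have L2 : angle_sum P bd (epoint P e t + s *: - enormal P e) @[s --> 0^'+] --> angle_sum P bd x.
  apply: (@cvg_trans _ (angle_sum P bd x @[u --> (0 : R)^'+])); last exact: cvg_cst.
  apply: near_eq_cvg; apply: filterS (Dleft e t01) => s Ds.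
  by rewrite scalerN; exact: angle_sum_constant.
exact: (cvg_unique _ J L2).
Qed.

Lemma angle_sum_epoint_const : exists kappa,
  forall (e : 'I_NY) (t : R), 0 < t < 1 -> angle_sum P bd (epoint P e t) = kappa.
Proof.
have [[x Dx]|nD] := pselect (exists x, D x).
  by exists (angle_sum P bd x - pi) => e t t01; rewrite -(angle_sum_epoint e t01 Dx) addrK.
(* With [D] empty there is no edge at all, since every edge has points of [D] on its left. *)
exists 0 => e t t01; exfalso; apply: nD.
have [d Dd] := filter_ex (Dleft e t01).
by exists (epoint P e t - d *: enormal P e).
Qed.

Lemma exists_between_notin (a b : R) (s : seq R) : a < b ->
  exists t, a < t < b /\ t \notin s.
Proof.
elim: s a b => [|x s IH] a b ab.
  by exists ((a + b) / 2); split=> //; apply/andP; split; lra.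
have [ax|xa] := ltP a x.
  have [|t [/andP[a1 t1] ts]] := IH a (Num.min b x); first by rewrite lt_min ab.
  move: t1; rewrite lt_min => /andP[t1 t2]; exists t; split; first by rewrite a1.
  by rewrite inE negb_or ts lt_eqF.
have [t [/andP[a1 t1] ts]] := IH _ _ ab; exists t; split; first by rewrite a1.
by rewrite inE negb_or ts andbT gt_eqF// (le_lt_trans xa).
Qed.

(* A line normal to an edge, through no vertex, is followed to its last
   crossing with the boundary. *)
Lemma last_crossing (e0 : 'I_NY) : exists (e : 'I_NY) (t : R) (m : 'rV[R]_2),
  [/\ 0 < t < 1, cross (B e - A e) m != 0
    & forall s, 0 < s -> ~ bdset (epoint P e t + s *: m)].
Proof.
pose E0 := B e0 - A e0; pose m := perp E0.
have cE0 : cross E0 m = dot E0 E0 by rewrite /m /perp /cross /dot !mxE/=; ring.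
have E0gt : 0 < dot E0 E0 by rewrite dotxx_gt0 subr_eq0 eq_sym edge_neq.
(* The excluded values are the parameters of the orthogonal projections of the vertices onto the
   line of [e0], so the normal at [t0] misses every vertex. *)
have [t0 [t001 t0N]] := @exists_between_notin 0 1
  [seq cross (P v - A e0) m / dot E0 E0 | v <- enum 'I_n] ltr01.
pose x0 := epoint P e0 t0.
have offline v s : P v != x0 + s *: m.
  apply: contra t0N => /eqP vE; apply/mapP; exists v; first by rewrite mem_enum.
  rewrite vE /x0 /epoint /segment_point -cE0 (_ : cross _ m = t0 * cross E0 m).
    by rewrite mulfK// cE0 gt_eqF.
  by rewrite /E0 /cross !mxE; ring.
have cross_offline v : cross (P v - x0) m != 0.
  have mm : dot m m = dot E0 E0 by rewrite /m /perp /dot !mxE/=; ring.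
  pose q := dot (P v - x0) m / dot m m.
  have qE : q * dot m m = dot (P v - x0) m by rewrite /q divfK// mm gt_eqF.
  apply: contra_neq (offline v q) => c0.
  apply/eqP; rewrite -subr_eq0 -dotxx_eq0 opprD addrA -scaleNr.
  have := dot_cross_sqr (P v - x0 + (- q) *: m) m.
  rewrite dotDZl crossDZl c0 (_ : cross m m = 0); last by rewrite /cross; ring.
  rewrite mulNr qE subrr mulr0 addr0 expr0n/= addr0 => /esym/eqP.
  by rewrite mulf_eq0 mm (gt_eqF E0gt) orbF.
pose crosses e s := segment (A e) (B e) (x0 + s *: m).
(* As no vertex lies on the line, an edge that meets it does so at an interior point and
   transversally, hence only once. *)
have transverse e s : crosses e s -> cross (B e - A e) m != 0 /\
    exists2 t, 0 < t < 1 & x0 + s *: m = epoint P e t.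
  move=> [t /=]; rewrite in_itv/= => /andP[t0' t1'] xE.
  have cE : cross (A e - x0) m = - t * cross (B e - A e) m.
    have -> : A e - x0 = s *: m - t *: (B e - A e).
      have -> : x0 = segment_point (A e) (B e) t - s *: m by rewrite xE addrK.
      by rewrite /segment_point; apply/rowP => i; rewrite !mxE; ring.
    by rewrite /cross !mxE; ring.
  split.
    by apply: contra_neq (cross_offline (esrc e)) => c0; rewrite cE c0 mulr0.
  exists t; last by rewrite -xE.
  rewrite !lt_neqAle t0' t1' !andbT; apply/andP; split.
    apply: contra_neq (offline (esrc e) s) => tE.
    by rewrite -xE -tE /segment_point scale0r addr0.
  apply: contra_neq (offline (edst e) s) => tE.
  by rewrite -xE tE /segment_point scale1r addrC subrK.
have crosses_uniq e s s' : crosses e s -> crosses e s' -> s = s'.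
  move=> c1 c2; have [cn [t _ xE]] := transverse _ _ c1; have [_ [t' _ xE']] := transverse _ _ c2.
  have H : (s - s') *: m = (t - t') *: (B e - A e).
    have -> : (s - s') *: m = (x0 + s *: m) - (x0 + s' *: m).
      by rewrite scalerBl opprD addrACA subrr add0r.
    by rewrite xE xE'; apply/rowP => i; rewrite !mxE; ring.
  have tt : t - t' = 0.
    have : (t - t') * cross (B e - A e) m = 0.
      transitivity (cross ((t - t') *: (B e - A e)) m); first by rewrite /cross !mxE; ring.
      by rewrite -H /cross !mxE; ring.
    by move=> /eqP; rewrite mulf_eq0 (negbTE cn) orbF => /eqP.
  move: H; rewrite tt scale0r => /eqP; rewrite scaler_eq0 subr_eq0 => /orP[/eqP//|/eqP m0].
  by move: cn; rewrite m0 /cross !mxE !mulr0 subrr eqxx.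
(* The parameter of the crossing with [e]. The default 0 is harmless because the maximum is taken
   over the crossed edges [C] only, and [e0] is one of them. *)
pose f e := xget 0 [set s | crosses e s].
pose C := [pred e | `[< exists s, crosses e s >]].
have fP e : C e -> crosses e (f e).
  by move=> /asboolP[s cs]; rewrite /f; case: xgetP => [y _ //|/(_ s)].
have C0 : C e0.
  apply/asboolP; exists 0; exists t0; first by rewrite /= in_itv/= !ltW//; case/andP: t001.
  by rewrite scale0r addr0.
have [e Ce emax] := @Order.TotalTheory.arg_maxP _ _ _ e0 C f C0.
have [cn [t t01 xE]] := transverse _ _ (fP e Ce).
exists e, t, m; split=> // s s0 [e' se'].
have c' : crosses e' (f e + s).
  by rewrite /crosses scalerDl addrA xE.
have Ce' : C e' by apply/asboolP; exists (f e + s).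
have := emax e' Ce'; rewrite (crosses_uniq _ _ _ (fP e' Ce') c').
by rewrite /= gerDl leNgt s0.
Qed.

(** [Dleft] speaks of the normal direction. A general leftward direction is reached from it along a
    short segment that stays strictly left of the edge and too close to the point to meet another
    edge. *)
Lemma left_direction_enters (e : 'I_NY) (t : R) (m : 'rV[R]_2) : 0 < t < 1 ->
  0 < cross (B e - A e) m -> \forall s \near 0^'+, D (epoint P e t + s *: m).
Proof.
move=> t01 c0; set x := epoint P e t.
pose k := m + enormal P e.
(* A bound for all intermediate directions between the inner normal and [m]; the added 1 makes it
   positive. *)
pose M := `|enormal P e| + `|k| + 1.
have M0 : 0 < M by rewrite ltr_wpDl ?addr_ge0.
have far : \forall y \near x, forall e', e != e' -> ~ segment (A e') (B e') y.
  apply: (filter_forall (nbhs_filter x)) => e'.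
  have [<-|ee] := eqVneq e e'; first by apply/nbhs_ballP; exists 1 => //= y _.
  have cl : closed (segment (A e') (B e')).
    apply: compact_closed; first exact: norm_hausdorff.
    apply: continuous_compact; last exact: segment_compact.
    by apply: continuous_subspaceT; exact: line_continuous.
  have := open_nbhs_nbhs (conj (closed_openC cl) (edge_disj ee t01)).
  by apply: filterS => y.
have /nbhs_ballP[r /= r0 rfar] := far.
near=> s.
have s0 : 0 < s by near: s; exact: nbhs_right_gt.
have sr : s < r / M by near: s; apply: nbhs_right_lt; rewrite divr_gt0.
have -> : x + s *: m = (x - s *: enormal P e) + s *: k.
  by apply/rowP => i; rewrite !mxE; ring.
apply: segment_stays_inside; first by near: s; exact: Dleft.
move=> u /andP[u0 u1] [e'].
have -> : x - s *: enormal P e + u *: (s *: k) = x + s *: (- enormal P e + u *: k).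
  by apply/rowP => i; rewrite !mxE; ring.
have [<-|ee] := eqVneq e e'; last first.
  apply: rfar => //; rewrite -ball_normE /= opprD addNKr normrN normrZ gtr0_norm//.
  apply: (@le_lt_trans _ _ (s * M)); last by rewrite -ltr_pdivlMr.
  rewrite ler_pM2l//; apply: (le_trans (ler_normD _ _)).
  rewrite normrN normrZ ger0_norm// /M -addrA lerD2l ler_wpDr//.
  by rewrite ler_piMl.
move=> [w _ /eqP]; rewrite -subr_eq0 => /eqP H.
have : cross (B e - A e) (- enormal P e + u *: k) = 0.
  have := congr1 (fun v => cross (B e - A e) v) H.
  rewrite /x /epoint /segment_point /cross !mxE => H'.
  have /eqP : s * (cross (B e - A e) (- enormal P e + u *: k)) = 0.
    by rewrite -[RHS]oppr0 -[X in _ = - X](mulr0 (0 : R)); move: H'; rewrite /cross !mxE; lra.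
  by rewrite mulf_eq0 (gt_eqF s0)/= /cross !mxE => /eqP.
have -> : cross (B e - A e) (- enormal P e + u *: k) =
    (1 - u) * cross (B e - A e) (- enormal P e) + u * cross (B e - A e) m.
  by rewrite /k /cross !mxE; ring.
have en := enormal_left e.
have [->|un] := eqVneq u 1.
  by rewrite subrr mul0r add0r mul1r => c; move: c0; rewrite c ltxx.
move=> c; have : 0 < (1 - u) * cross (B e - A e) (- enormal P e) + u * cross (B e - A e) m.
  by rewrite ltr_wpDr ?mulr_ge0 ?(ltW c0)// mulr_gt0// subr_gt0 lt_neqAle un.
by rewrite c ltxx.
Unshelve. all: by end_near. Qed.

(** The ray beyond the last crossing leaves to the right of its edge: to the left it would enter [D]
    and, meeting no boundary, stay there, against boundedness. On the right the jump is [- pi] and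
    the limit is 0, so the value on the edge is [pi]. *)
Lemma angle_sum_epoint_bounded : bounded_set D ->
  forall (e : 'I_NY) (t : R), 0 < t < 1 -> angle_sum P bd (epoint P e t) = pi.
Proof.
move=> Db e0 t0 t001.
have [e [t [m [t01 cn ray]]]] := last_crossing e0.
have m0 : m != 0.
  by apply: contra_neq cn => ->; rewrite /cross !mxE !mulr0 subrr.
have zero := angle_sum_ray m0 ray.
have [x Dx] : exists x, D x.
  by have [d Dd] := filter_ex (Dleft e0 t001); exists (epoint P e0 t0 - d *: enormal P e0).
have kE : angle_sum P bd (epoint P e0 t0) = angle_sum P bd (epoint P e t).
  by apply: (addIr pi); rewrite !(angle_sum_epoint _ _ Dx).
have Z : angle_sum P bd (epoint P e t + s *: m) @[s --> 0^'+] --> (0 : R).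
  apply: (@cvg_trans _ ((0 : R) @[s --> (0 : R)^'+])); last exact: cvg_cst.
  by apply: near_eq_cvg; near=> s; rewrite zero.
have [cgt|cle] := ltP 0 (cross (B e - A e) m); last first.
  have clt : cross (B e - A e) m < 0 by rewrite lt_neqAle cn.
  have J := angle_sum_jump t01 (angle_jump_right t01 clt).
  have E : angle_sum P bd (epoint P e t) - pi = 0 := cvg_unique _ J Z.
  by rewrite kE; apply/eqP; rewrite -subr_eq0 E.
exfalso.
have [s [s0 Ds]] : exists s, 0 < s /\ D (epoint P e t + s *: m).
  have H := left_direction_enters t01 cgt.
  have [s [? ?]] := filter_ex (filterI (nbhs_right_gt 0) H).
  by exists s.
have Dray u : 0 <= u -> D (epoint P e t + s *: m + u *: m).
  move=> u0; apply: segment_stays_inside => // v /andP[v0 v1].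
  rewrite scalerA -addrA -scalerDl; apply: ray.
  by rewrite ltr_wpDr ?mulr_ge0.
have [M [_ HM]] := Db.
have MM : M < M + 1 by rewrite ltrDl.
have bound := HM _ MM.
have nm : 0 < `|m| by rewrite normr_gt0.
pose y := epoint P e t + s *: m.
(* Chosen so that the point at parameter [u] has norm at least [|M| + 2], beyond the bound
   [M + 1]. *)
pose u := (`|M| + 2 + `|y|) / `|m|.
have u0 : 0 <= u by rewrite divr_ge0// ?addr_ge0.
have := bound _ (Dray u u0).
have := lerB_normD (u *: m) y.
rewrite normrZ ger0_norm// /u divfK ?gt_eqF// addrK [u *: m + y]addrC => h1 h2.
have := le_trans h1 h2; have := ler_norm M; lra.
Unshelve. all: by end_near. Qed.

End Winding.

(** * Edges of the network and boundary edges of its regions *)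

Lemma segmentC (R : realType) (a b : 'rV[R]_2) : segment a b = segment b a.
Proof.
have H (c d : 'rV[R]_2) : segment c d `<=` segment d c.
  move=> x [t t01 <-]; exists (1 - t).
    by move: t01; rewrite /= !in_itv/= => /andP[? ?]; apply/andP; split; lra.
  by apply/rowP => i; rewrite /segment_point !mxE; ring.
by apply/seteqP; split; exact: H.
Qed.

Lemma segment_pointC (R : realType) (a b : 'rV[R]_2) (t : R) :
  segment_point a b t = segment_point b a (1 - t).
Proof. by apply/rowP => i; rewrite /segment_point !mxE; ring. Qed.

Lemma right_normalC (R : realType) (a b : 'rV[R]_2) :
  right_normal b a = - right_normal a b.
Proof.
have E : enorm (a - b) = enorm (b - a).
  by rewrite -(opprB b a) -scaleN1r enormZ normrN1 mul1r.
rewrite /right_normal E.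
by apply/rowP => i; rewrite /perp !mxE; case: ifP => _; ring.
Qed.

Lemma segment_closed (R : realType) (a b : 'rV[R]_2) : closed (segment a b).
Proof.
apply: compact_closed; first exact: norm_hausdorff.
apply: continuous_compact; last exact: segment_compact.
by apply: continuous_subspaceT; exact: line_continuous.
Qed.

Lemma bedges_exists (n : nat) (bd : seq (seq 'I_n)) c v : c \in bd -> v \in c ->
  exists e : 'I_(size (bedges bd)), esrc e = v /\ edst e = next c v.
Proof.
move=> cbd vc; have uv : (v, next c v) \in bedges bd.
  apply/flattenP; exists [seq (v, next c v) | v <- c]; last exact: map_f.
  by apply/mapP; exists c.
have [e eE] := seq_tnthP uv.
by exists e; rewrite /esrc /edst -eE.
Qed.

Lemma bedges_fst (n : nat) (bd : seq (seq 'I_n)) : unzip1 (bedges bd) = flatten bd.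
Proof.
rewrite /bedges /unzip1 map_flatten -map_comp; congr flatten.
by rewrite -[RHS]map_id; apply: eq_map => c /=; rewrite -map_comp map_id.
Qed.

Lemma esrc_inj (n : nat) (bd : seq (seq 'I_n)) : uniq (flatten bd) ->
  injective (@esrc n bd).
Proof.
move=> bdU e e' ee; apply/val_inj/eqP.
have Z (f : 'I_(size (bedges bd))) : esrc f = nth (esrc e) (flatten bd) f.
  rewrite -bedges_fst /unzip1 (nth_map (tnth (in_tuple (bedges bd)) e))//.
  by rewrite /esrc (tnth_nth (tnth (in_tuple (bedges bd)) e)).
have sz : size (flatten bd) = size (bedges bd) by rewrite -bedges_fst size_map.
rewrite -(nth_uniq (esrc e) _ _ bdU) ?sz ?ltn_ord//.
by rewrite -!Z ee.
Qed.

Section NetworkGeometry.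
Context {R : realType} (G : network R).
Hypothesis hG : polygonal_network G.

Local Notation vtx := (node (vpos G)).
Local Notation NY r := (size (bedges (bdry (r : 'I_(nbounded G).+1)))).

Lemma vidx_ordS_neq (i : 'I_(ncurves G)) (k : 'I_(csize i)) : vidx k != vidx (ordS k).
Proof.
apply/eqP => /(pn_vidx_inj hG)/(congr1 val)/= kE.
have sz : (1 < csize i)%N.
  by have := pn_csize hG i; case: ifP => _ // /ltnW.
move: kE; have [lt|ge] := ltnP k.+1 (csize i).
  by rewrite modn_small// => /eqP; rewrite ltn_eqF.
have kE : k.+1 = csize i by apply/eqP; rewrite eqn_leq ge ltn_ord.
by rewrite kE modnn => k0; move: kE sz; rewrite k0 => <-.
Qed.

(** Distinct edges share only end vertices, and an interior point of an edge is neither of its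
    ends. *)
Lemma open_edge_unique (i : 'I_(ncurves G)) (k : 'I_(csize i)) i' (k' : 'I_(csize i')) (t : R) :
  is_edge k -> is_edge k' -> 0 < t < 1 ->
  edge_seg k' (segment_point (edge_src k) (edge_dst k) t) ->
  Tagged (fun i => 'I_(csize i)) k = Tagged (fun i => 'I_(csize i)) k'.
Proof.
move=> ek ek' /andP[t0 t1] xk'; apply: contrapT => /eqP kk'.
have xk : edge_seg k (segment_point (edge_src k) (edge_dst k) t).
  by exists t => //; rewrite /= in_itv/= !ltW.
have [j [xE jk _]] := pn_embedded hG ek ek' kk' xk xk'.
have e0 : edge_dst k - edge_src k != 0.
  by rewrite subr_eq0 (inj_eq (pn_vertex_inj hG)) eq_sym vidx_ordS_neq.
move: jk xE; rewrite !inE => /orP[]/eqP -> /eqP; rewrite -subr_eq0 /segment_point.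
  by rewrite addrC addrA addNr add0r scaler_eq0 (gt_eqF t0) (negbTE e0).
have -> : edge_src k + t *: (edge_dst k - edge_src k) - node (vpos G) (vidx (ordS k)) =
    (t - 1) *: (edge_dst k - edge_src k).
  by apply/rowP => l; rewrite /edge_dst !mxE; ring.
by rewrite scaler_eq0 subr_eq0 (lt_eqF t1) (negbTE e0).
Qed.

Lemma region_component (r : 'I_(nbounded G).+1) x : region r x ->
  region r = connected_component (~` carrier G) x.
Proof.
move=> rx; have : range (@region R G) (region r) by exists r.
rewrite (pn_regions hG) => -[y yC yE]; rewrite -yE.
apply/seteqP; split=> z.
  have xy : connected_component (~` carrier G) x y.
    by apply: connected_component_sym; rewrite yE.
  exact: connected_component_trans.
have xy : connected_component (~` carrier G) y x by rewrite yE.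
exact: connected_component_trans.
Qed.

Lemma region_unique (r r' : 'I_(nbounded G).+1) x : region r x -> region r' x -> r = r'.
Proof.
move=> rx r'x; apply: (pn_region_inj hG).
by rewrite (region_component rx) (region_component r'x).
Qed.

Lemma region_carrier (r : 'I_(nbounded G).+1) x : region r x -> ~ carrier G x.
Proof.
move=> rx; move: (rx); rewrite (region_component rx).
by move=> /connected_component_sub.
Qed.

Lemma region_connected r : connected (@region R G r).
Proof.
have [[x rx]|nr] := pselect (exists x, region r x).
  by rewrite (region_component rx); exact: component_connected.
have -> : region r = set0 by apply/seteqP; split=> x // rx; exfalso; apply: nr; exists x.
exact: connected0.
Qed.

Lemma carrier_closed : closed (carrier G).
Proof.
rewrite -[carrier G]setCK; apply: open_closedC; rewrite openE => x xN.
have H (a : {i : 'I_(ncurves G) & 'I_(csize i)}) :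
    \forall y \near x, is_edge (tagged a) -> ~ edge_seg (tagged a) y.
  have [ea|ea] := boolP (is_edge (tagged a)); last by apply/nbhs_ballP; exists 1 => //= y _.
  have xa : (~` edge_seg (tagged a)) x.
    by move=> xa; apply: xN; exists (tag a), (tagged a).
  have := open_nbhs_nbhs (conj (closed_openC (@segment_closed _ _ _)) xa).
  by apply: filterS => y.
apply: filterS (filter_forall (nbhs_filter x) H) => y yN [i [k [ek yk]]].
exact: (yN (Tagged (fun i => 'I_(csize i)) k)).
Qed.

(** The carrier is closed, so a ball around the point avoids it, and each point of the ball is
    joined to the centre by a radius in the same component. *)
Lemma region_open r : open (@region R G r).
Proof.
rewrite openE => x rx.
have xN : nbhs x (~` carrier G).
  by apply: open_nbhs_nbhs; split; [exact: closed_openC carrier_closed|exact: region_carrier rx].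
have /nbhs_ballP[d /= d0 dN] := xN.
apply/nbhs_ballP; exists d => //= y xy; rewrite (region_component rx).
pose L := [set x + s *: (y - x) | s in `[(0 : R), 1]].
have Lc : connected L.
  apply: connected_continuous_connected.
    by apply/connected_intervalP; exact: interval_is_interval.
  by apply: continuous_subspaceT; exact: line_continuous.
have Lx : L x by exists 0; rewrite /= ?in_itv/= ?lexx ?ler01// scale0r addr0.
have LC : L `<=` ~` carrier G.
  move=> z [s]; rewrite /= in_itv/= => /andP[s0 s1] <-; apply: dN.
  move: xy; rewrite -!ball_normE/= => xy.
  rewrite opprD addrA subrr sub0r normrN normrZ ger0_norm//.
  by apply: le_lt_trans xy; rewrite distrC ler_piMl.
apply: (connected_component_max Lx LC Lc).
by exists 1; rewrite /= ?in_itv/= ?lexx ?ler01// scale1r addrC subrK.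
Qed.

Lemma bdry_uniq r : uniq (flatten (@bdry R G r)).
Proof. exact: bd_uniq (pn_boundary hG r). Qed.

Lemma bdry_left r (e : 'I_(NY r)) (t : R) : 0 < t < 1 ->
  \forall d \near 0^'+, region r (epoint vtx e t - d *: enormal vtx e).
Proof.
move=> t01; have [c cbd [vc eE]] := edge_mem e.
by have := bd_left (pn_boundary hG r) cbd vc t01; rewrite -eE.
Qed.

Lemma bdry_set r : bdset vtx (bdry r) = closure (region r) `\` region r.
Proof.
have -> : closure (region r) `\` region r = closure (region r) `\` interior (region r).
  by rewrite (interior_id _).1//; exact: region_open.
rewrite -(bd_cover (pn_boundary hG r)); apply/seteqP; split=> x.
  move=> [e xe]; have [c cbd [vc eE]] := edge_mem e.
  by exists c, (esrc e); rewrite -eE.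
move=> [c [v [cbd vc xv]]]; have [e [eu ev]] := bedges_exists cbd vc.
by exists e; rewrite eu ev.
Qed.

(** A boundary edge has its region on the left, and the curve normal points to the right. Running
    along the curve thus means lying on the [phase_neg] side, running against it on the [phase_pos]
    side. *)
Definition forward r (e : 'I_(NY r)) (i : 'I_(ncurves G)) (k : 'I_(csize i)) :=
  esrc e = vidx k /\ edst e = vidx (ordS k).
Definition backward r (e : 'I_(NY r)) (i : 'I_(ncurves G)) (k : 'I_(csize i)) :=
  edst e = vidx k /\ esrc e = vidx (ordS k).

Lemma bdry_adjacent r (e : 'I_(NY r)) : exists i (k : 'I_(csize i)),
  is_edge k /\ (forward e k \/ backward e k).
Proof.
have [c cbd [vc eE]] := edge_mem e.
have [i [k [ek H]]] := bd_edge (pn_boundary hG r) cbd vc.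
exists i, k; split=> //; rewrite /forward /backward eE.
by case: H => H; [left|right].
Qed.

Lemma bdry_edge_seg r (e : 'I_(NY r)) i (k : 'I_(csize i)) :
  forward e k \/ backward e k -> segment (vtx (esrc e)) (vtx (edst e)) = edge_seg k.
Proof. by case=> -[-> ->]; rewrite // segmentC. Qed.

Lemma forward_phase r (e : 'I_(NY r)) i (k : 'I_(csize i)) : is_edge k ->
  forward e k -> phase_of r = phase_neg i.
Proof.
move=> ek [eu ev].
have h : 0 < (2^-1 : R) < 1 by apply/andP; split; lra.
have S := pn_sides hG ek h.
have L := bdry_left e h; rewrite /epoint /enormal eu ev in L.
have [d [[_ [r' rp r'x]] rx]] := filter_ex (filterI S L).
by rewrite -rp; congr phase_of; exact: region_unique rx r'x.
Qed.

Lemma backward_phase r (e : 'I_(NY r)) i (k : 'I_(csize i)) : is_edge k ->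
  backward e k -> phase_of r = phase_pos i.
Proof.
move=> ek [ev eu].
have h : 0 < (2^-1 : R) < 1 by apply/andP; split; lra.
have S := pn_sides hG ek h.
have L := bdry_left e h; rewrite /epoint /enormal eu ev right_normalC segment_pointC in L.
have hh : 1 - 2^-1 = 2^-1 :> R by lra.
rewrite hh in L.
have [d [[[r' rp r'x] _] rx]] := filter_ex (filterI S L).
rewrite -rp; congr phase_of; apply: region_unique r'x.
by move: rx; rewrite scalerN opprK.
Qed.

Lemma bdry_edge_neq r (e : 'I_(NY r)) : vtx (esrc e) != vtx (edst e).
Proof.
have [i [k [ek H]]] := bdry_adjacent e; rewrite (inj_eq (pn_vertex_inj hG)).
by case: H => -[eu ev]; rewrite eu ev ?vidx_ordS_neq// eq_sym vidx_ordS_neq.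
Qed.

Lemma epoint_edge_point r (e : 'I_(NY r)) i (k : 'I_(csize i)) (t : R) :
  forward e k \/ backward e k -> 0 < t < 1 ->
  exists2 s, 0 < s < 1 & epoint vtx e t = segment_point (edge_src k) (edge_dst k) s.
Proof.
move=> [] [eu ev] t01; first by exists t => //; rewrite /epoint eu ev.
exists (1 - t); first by case/andP: t01 => ? ?; apply/andP; split; lra.
by rewrite /epoint eu ev segment_pointC.
Qed.

(** Two boundary edges of a region cannot share a curve edge: in the same direction they would have
    the same source vertex, in opposite directions the region would belong to both phases of the
    curve. *)
Lemma bdry_edge_disj r (e e' : 'I_(NY r)) (t : R) : e != e' -> 0 < t < 1 ->
  ~ segment (vtx (esrc e')) (vtx (edst e')) (epoint vtx e t).
Proof.
move=> ee t01 xe'.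
have [i [k [ek H]]] := bdry_adjacent e; have [i' [k' [ek' H']]] := bdry_adjacent e'.
have [s s01 xE] := epoint_edge_point H t01.
move: xe'; rewrite (bdry_edge_seg H') xE => xk'.
have kk := open_edge_unique ek ek' s01 xk'.
pose Q (a : {i : 'I_(ncurves G) & 'I_(csize i)}) :=
  forward e' (tagged a) \/ backward e' (tagged a).
have {H'} : Q (Tagged _ k') by [].
rewrite -kk => /= H'; case: H H' => -[eu ev] [] [/= eu' ev'].
- by move: ee; rewrite (esrc_inj (bdry_uniq r) (etrans eu (esym eu'))) eqxx.
- have := pn_phases_neq hG i.
  by rewrite -(forward_phase ek (conj eu ev))
      -(backward_phase ek (conj eu' ev' : backward e' k)) eqxx.
- have := pn_phases_neq hG i.
  by rewrite -(forward_phase ek (conj eu' ev' : forward e' k))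
      -(backward_phase ek (conj eu ev)) eqxx.
- by move: ee; rewrite (esrc_inj (bdry_uniq r) (etrans ev (esym ev'))) eqxx.
Qed.

Lemma const1_region_dtn r :
  (const_mx 1 : 'cV[R]_(size (bverts (bdry r))))^T *m @region_dtn R G r = 0.
Proof.
have U := bdry_uniq r; have N := @bdry_edge_neq r; have Dj := @bdry_edge_disj r.
have O := region_open (r := r); have C := region_connected (r := r).
have B := bdry_set r; have L := @bdry_left r.
rewrite /region_dtn; case: ifPn => [_|rN].
  have [kappa kE] := angle_sum_epoint_const U N Dj O C B L.
  exact: (const1_dtn_unbounded U N Dj kE).
apply: (const1_dtn_bounded U N Dj).
by apply: (angle_sum_epoint_bounded U N Dj O C B L); exact/(pn_bounded hG).
Qed.

Lemma const1_Lambda : (const_mx 1 : 'cV[R]_(nverts G))^T *m Lambda G = 0.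
Proof.
rewrite /Lambda mulmx_sumr big1// => r _.
by rewrite !mulmxA -trmx_mul restriction_mx_const const1_region_dtn mul0mx.
Qed.

(** A phase has finitely many regions, so a point approached from within it is in the closure of one
    of them. Being on the carrier, the point is on the boundary of that region, and the boundary
    edge through it must be the given one. *)
Lemma edge_in_closure_region (i : 'I_(ncurves G)) (k : 'I_(csize i)) (t : R)
    (p : 'I_(nphases G)) (f : R -> 'rV[R]_2) :
  is_edge k -> f d @[d --> 0^'+] --> segment_point (edge_src k) (edge_dst k) t ->
  0 < t < 1 -> (\forall d \near 0^'+, in_phase p (f d)) ->
  exists r (e : 'I_(NY r)), phase_of r = p /\ (forward e k \/ backward e k).
Proof.
move=> ek; set x := segment_point _ _ _ => fx t01 fp.
have xk : edge_seg k x by exists t => //; rewrite /= in_itv/= !ltW//; case/andP: t01.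
have [r [rp rx]] : exists r, phase_of r = p /\ closure (region r) x.
  apply: contrapT => H.
  have K r : \forall d \near 0^'+, phase_of r = p -> ~ region r (f d).
    have [rp|rp] := pselect (phase_of r = p); last by near=> d => /rp.
    have xN : (~` closure (region r)) x by move=> cx; apply: H; exists r.
    have nb := fx (~` closure (region r))
      (open_nbhs_nbhs (conj (closed_openC (@closed_closure _ (region r))) xN)).
    have sub : f @^-1` (~` closure (region r)) `<=` (fun d => phase_of r = p -> ~ region r (f d)).
      by move=> d fN _ rd; apply: fN; exact: subset_closure.
    exact: (@filterS _ ((0 : R)^'+) _ _ _ sub nb).
  have Kall : \forall d \near 0^'+, forall r, phase_of r = p -> ~ region r (f d).
    exact: filter_forall.
  have [d [ph dN]] := @filter_ex _ ((0 : R)^'+) _ _ (filterI fp Kall).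
  by case: ph => r rp rd; exact: (dN r rp rd).
have : bdset vtx (bdry r) x.
  rewrite bdry_set; split=> // rx'; apply: (region_carrier rx').
  by exists i, k.
move=> [e xe]; exists r, e; split=> //.
have [i' [k' [ek' H']]] := bdry_adjacent e.
rewrite (bdry_edge_seg H') in xe.
have kk := open_edge_unique ek ek' t01 xe.
pose Q (a : {i : 'I_(ncurves G) & 'I_(csize i)}) :=
  forward e (tagged a) \/ backward e (tagged a).
have : Q (Tagged _ k') by [].
by rewrite -kk.
Unshelve. all: by end_near. Qed.

Lemma line_cvg_at_right (x m : 'rV[R]_2) : x + d *: m @[d --> (0 : R)^'+] --> x.
Proof.
have := cvg_at_right_filter (@line_continuous R x m 0).
by rewrite scale0r addr0.
Qed.

Lemma forward_exists (i : 'I_(ncurves G)) (k : 'I_(csize i)) : is_edge k ->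
  exists r (e : 'I_(NY r)), phase_of r = phase_neg i /\ forward e k.
Proof.
move=> ek; have h : 0 < (2^-1 : R) < 1 by apply/andP; split; lra.
have S := pn_sides hG ek h.
have := @line_cvg_at_right (segment_point (edge_src k) (edge_dst k) 2^-1)
  (- right_normal (edge_src k) (edge_dst k)) => c.
have [|r [e [rp H]]] := edge_in_closure_region ek c h (p := phase_neg i).
  by apply: filterS S => d [_ H]; rewrite scalerN; exact: H.
exists r, e; split=> //; case: H => // bw.
by have := pn_phases_neq hG i; rewrite -rp (backward_phase ek bw) eqxx.
Qed.

Lemma backward_exists (i : 'I_(ncurves G)) (k : 'I_(csize i)) : is_edge k ->
  exists r (e : 'I_(NY r)), phase_of r = phase_pos i /\ backward e k.
Proof.
move=> ek; have h : 0 < (2^-1 : R) < 1 by apply/andP; split; lra.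
have S := pn_sides hG ek h.
have := @line_cvg_at_right (segment_point (edge_src k) (edge_dst k) 2^-1)
  (right_normal (edge_src k) (edge_dst k)) => c.
have [|r [e [rp H]]] := edge_in_closure_region ek c h (p := phase_pos i).
  by apply: filterS S => d [].
exists r, e; split=> //; case: H => // fw.
by have := pn_phases_neq hG i; rewrite -rp (forward_phase ek fw) eqxx.
Qed.

Lemma bedge_region_unique r r' (e : 'I_(NY r)) (e' : 'I_(NY r')) :
  esrc e = esrc e' -> edst e = edst e' -> r = r'.
Proof.
move=> eu ev; have h : 0 < (2^-1 : R) < 1 by apply/andP; split; lra.
have L := bdry_left e h; have := bdry_left e' h.
rewrite /epoint /enormal -eu -ev => L'.
have [d [rx r'x]] := filter_ex (filterI L L').
exact: region_unique rx r'x.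
Qed.

End NetworkGeometry.

(** * The flux identity *)

Section PhaseArea.
Context {R : realType} (G : network R).
Hypothesis hG : polygonal_network G.

Local Notation N := (nverts G).
Local Notation vtx := (node (vpos G)).
Local Notation NY r := (size (bedges (bdry (r : 'I_(nbounded G).+1)))).

(* Each edge of a curve bounding [p] occurs exactly once on the boundaries of the
   regions of phase [p], traversed with [p] on its left. *)
Lemma sum_phase_edges (p : 'I_(nphases G)) (F : 'I_N -> 'I_N -> R) :
  \sum_(r < (nbounded G).+1 | phase_of r == p)
     \sum_(c <- bdry r) \sum_(v <- c) F v (next c v) =
  \sum_(i < ncurves G) \sum_(k < csize i | is_edge k)
    ((p == phase_neg i)%:R * F (vidx k) (vidx (ordS k))
     + (p == phase_pos i)%:R * F (vidx (ordS k)) (vidx k)).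
Proof.
pose TL : finType := {r : 'I_(nbounded G).+1 & 'I_(NY r)}.
pose SL : {set TL} := [set x : TL | phase_of (tag x) == p]%SET.
pose fL (x : TL) := (esrc (tagged x), edst (tagged x)).
(* The flag is the direction of travel: [true] follows the curve, with [phase_neg] on the left. *)
pose TR : finType := ({i : 'I_(ncurves G) & 'I_(csize i)} * bool)%type.
pose SR : {set TR} := [set y : TR | is_edge (tagged y.1) &&
   (p == if y.2 then phase_neg (tag y.1) else phase_pos (tag y.1))]%SET.
pose fR (y : TR) := if y.2 then (vidx (tagged y.1), vidx (ordS (tagged y.1)))
                    else (vidx (ordS (tagged y.1)), vidx (tagged y.1)).
have injL : {in SL &, injective fL}.
  move=> [r e] [r' e'] _ _ [] /= eu ev.
  have rr := bedge_region_unique hG eu ev; move: e' eu ev; case: _ / rr => e' eu _.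
  by rewrite (esrc_inj (bdry_uniq hG r) eu).
have seg_eq (y : TR) : segment (vtx (fR y).1) (vtx (fR y).2) = edge_seg (tagged y.1).
  by rewrite /fR; case: y.2; rewrite // segmentC.
have injR : {in SR &, injective fR}.
  move=> y y'; rewrite !inE => /andP[ey _] /andP[ey' _] yy.
  have h : 0 < (2^-1 : R) < 1 by apply/andP; split; lra.
  have aa : y.1 = y'.1.
    have : edge_seg (tagged y'.1)
        (segment_point (edge_src (tagged y.1)) (edge_dst (tagged y.1)) 2^-1).
      rewrite -seg_eq -yy seg_eq; exists 2^-1 => //.
      by rewrite /= in_itv/= !ltW//; case/andP: h.
    move=> /(open_edge_unique hG ey ey' h).
    by case: (y.1) => ? ?; case: (y'.1).
  move: yy {seg_eq ey ey'}; rewrite /fR aa.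
  case: y y' aa => [a b] [a' b'] /= ->.
  have ne := vidx_ordS_neq hG (tagged a').
  case: b b' => -[]// [] => [/eqP|_ /eqP]; first by rewrite (negbTE ne).
  by rewrite (negbTE ne).
(* Both sides of the claim sum [F] over the same set of directed vertex pairs. *)
have SE : [set fL x | x in SL]%SET = [set fR y | y in SR]%SET.
  apply/setP => uv; apply/imsetP/imsetP => -[].
    move=> [r e]; rewrite inE /= => /eqP rp ->.
    have [i [k [ek H]]] := bdry_adjacent hG e.
    case: H => -[eu ev].
      exists (Tagged (fun i => 'I_(csize i)) k, true); last by rewrite /fR /fL /= eu ev.
      by rewrite inE /= ek -(forward_phase hG ek (conj eu ev)) rp eqxx.
    exists (Tagged (fun i => 'I_(csize i)) k, false); last by rewrite /fR /fL /= eu ev.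
    by rewrite inE /= ek -(backward_phase hG ek (conj eu ev)) rp eqxx.
  move=> [[i k] []]; rewrite inE /= => /andP[ek /eqP pE] ->.
    have [r [e [rp [eu ev]]]] := forward_exists hG ek.
    exists (Tagged (fun r => 'I_(NY r)) e); last by rewrite /fR /fL /= eu ev.
    by rewrite inE /= rp pE.
  have [r [e [rp [eu ev]]]] := backward_exists hG ek.
  exists (Tagged (fun r => 'I_(NY r)) e); last by rewrite /fR /fL /= eu ev.
  by rewrite inE /= rp pE.
transitivity (\sum_(uv in [set fL x | x in SL]%SET) F uv.1 uv.2).
  rewrite big_imset//=.
  under eq_bigr do rewrite -(sum_edges (bdry _) F).
  rewrite sig_big_dep; apply: eq_bigl => x; by rewrite inE andbT.
rewrite SE big_imset//=.
transitivity (\sum_(a : {i : 'I_(ncurves G) & 'I_(csize i)} | is_edge (tagged a))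
   \sum_(b : bool | p == if b then phase_neg (tag a) else phase_pos (tag a))
     F (fR (a, b)).1 (fR (a, b)).2).
  rewrite pair_big_dep; apply: eq_big => [y|[a b] _//].
  by rewrite inE.
rewrite [RHS]sig_big_dep; apply: eq_bigr => a _.
by rewrite big_mkcond big_bool /=; do 2 case: ifP => _; rewrite ?mul1r ?mul0r.
Qed.

(** The sign is minus because a curve with [incidence] 1 has [p] on its right, so the boundary of
    [p] runs against it, and reversing an edge negates [F]. *)
Lemma sum_phase_antisym (p : 'I_(nphases G)) (F : 'I_N -> 'I_N -> R) :
  (forall u v, F v u = - F u v) ->
  \sum_(r < (nbounded G).+1 | phase_of r == p)
     \sum_(c <- bdry r) \sum_(v <- c) F v (next c v) =
  - \sum_(i < ncurves G) incidence p i *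
      \sum_(k < csize i | is_edge k) F (vidx k) (vidx (ordS k)).
Proof.
move=> FN; rewrite sum_phase_edges -sumrN; apply: eq_bigr => i _.
rewrite mulr_sumr -sumrN; apply: eq_bigr => k _.
rewrite [F (vidx (ordS k)) _]FN /incidence.
have := pn_phases_neq hG i.
have [->|pn] := eqVneq p (phase_neg i); last first.
  by move=> _; case: (p == phase_pos i) => /=; rewrite ?mulr1n ?mulr0n; ring.
by move=> /negbTE -> /=; rewrite ?mulr1n ?mulr0n; ring.
Qed.

Lemma nodeDZ (X Y : 'cV[R]_(N * 2)) (h : R) j :
  node (X + h *: Y) j = node X j + h *: node Y j.
Proof. by apply/rowP => c; rewrite !mxE. Qed.

(** The mixed term in the expansion of the quadratic form [phase_area], i.e. twice its symmetric
    bilinear form. *)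
Definition polar_area p (X Y : 'cV[R]_(N * 2)) : R :=
  2^-1 * - \sum_(i < ncurves G) incidence p i * \sum_(k < csize i | is_edge k)
    (cross (node X (vidx k)) (node Y (vidx (ordS k)))
     + cross (node Y (vidx k)) (node X (vidx (ordS k)))).

Lemma phase_areaE p X : phase_area G p X =
  2^-1 * - \sum_(i < ncurves G) incidence p i * \sum_(k < csize i | is_edge k)
    cross (node X (vidx k)) (node X (vidx (ordS k))).
Proof.
rewrite -(sum_phase_antisym p (F := fun u v => cross (node X u) (node X v))).
  by rewrite mulr_sumr.
by move=> u v; rewrite /cross; ring.
Qed.

Lemma phase_area_expand p (X Y : 'cV[R]_(N * 2)) (h : R) :
  phase_area G p (X + h *: Y) =
  phase_area G p X + h * polar_area p X Y + h ^+ 2 * phase_area G p Y.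
Proof.
rewrite /polar_area !phase_areaE.
rewrite !(mulrCA _ 2^-1) -!mulrDr; congr (_ * _).
rewrite !mulrN -!opprD; congr (- _); rewrite !mulr_sumr -!big_split.
apply: eq_bigr => i _ /=; rewrite !(mulrCA _ (incidence p i)) -!mulrDr; congr (_ * _).
rewrite !mulr_sumr -!big_split; apply: eq_bigr => k _ /=.
by rewrite !nodeDZ /cross !mxE; ring.
Qed.

Lemma hlen_gt0 (i : 'I_(ncurves G)) (k : 'I_(csize i)) : 0 < hlen k.
Proof.
rewrite enorm_gt0 subr_eq0 (inj_eq (pn_vertex_inj hG)) eq_sym.
exact: vidx_ordS_neq.
Qed.

Lemma hlen_edge_normal (i : 'I_(ncurves G)) (k : 'I_(csize i)) :
  hlen k *: edge_normal k = - perp (edge_dst k - edge_src k).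
Proof.
by rewrite /edge_normal /right_normal scalerN scalerA mulfV ?scale1r// gt_eqF// hlen_gt0.
Qed.

Lemma dot_perp (a b : 'rV[R]_2) : dot b (- perp a) = cross b a.
Proof. by rewrite /dot /cross /perp !mxE/=; ring. Qed.

(** The mass cancels the denominator of the averaged normal, leaving half the rotated vectors of the
    two adjacent edges. The indicators drop the wrap-around edge at the ends of an open curve, so
    both kinds of curve share one formula. *)
Lemma mu_vertex_normal (i : 'I_(ncurves G)) (k : 'I_(csize i)) :
  mu k *: vertex_normal k = 2^-1 *:
    ((is_edge k)%:R *: - perp (edge_dst k - edge_src k)
     + (is_edge (ord_pred k))%:R *: - perp (edge_dst (ord_pred k) - edge_src (ord_pred k))).
Proof.
rewrite -!hlen_edge_normal /mu /vertex_normal.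
have sz : (1 < csize i)%N by have := pn_csize hG i; case: ifP => _ // /ltnW.
(* [ord_pred] sends 0 to the last index, whose edge exists only on a closed curve. *)
have predE : is_edge (ord_pred k) = is_closed G i || (0 < k)%N.
  rewrite /is_edge /=; congr (_ || _).
  have [k0|k0] := posnP k.
    rewrite k0 add0n modn_small ?prednK ?ltnn ?(ltn_trans _ sz)//.
  rewrite -(prednK k0) addSn /= modnDr modn_small; last by rewrite (leq_ltn_trans (leq_pred _)).
  by rewrite prednK// ltn_ord.
case: ifPn => [|kend].
  move=> /andP[ncl]; have [k0|k0] := eqVneq (k : nat) 0%N => /=.
    move=> _; rewrite predE k0 ltnn orbF (negbTE ncl) scale0r addr0.
    by rewrite /is_edge k0 sz orbT scale1r scalerA.
  move=> /eqP kl; rewrite predE lt0n k0 orbT scale1r.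
  by rewrite /is_edge (negbTE ncl) kl ltnn scale0r add0r scalerA.
have e1 : is_edge k.
  rewrite /is_edge; case: (boolP (is_closed G i)) => //= ncl.
  move: kend; rewrite /is_end ncl/= negb_or => /andP[_ kl].
  by rewrite ltn_neqAle kl ltn_ord.
have e2 : is_edge (ord_pred k).
  rewrite predE; case: (boolP (is_closed G i)) => //= ncl.
  by move: kend; rewrite /is_end ncl/= negb_or lt0n => /andP[].
rewrite e1 e2 !scale1r scalerA mulfK; first by rewrite addrC.
by rewrite gt_eqF// addr_gt0 ?hlen_gt0.
Qed.

Lemma sum_mu_vertex_normal (i : 'I_(ncurves G)) (Y : 'cV[R]_(N * 2)) :
  \sum_(k < csize i) mu k * dot (node Y (vidx k)) (vertex_normal k) =
  2^-1 * \sum_(k < csize i | is_edge k)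
    cross (node Y (vidx k) + node Y (vidx (ordS k))) (edge_dst k - edge_src k).
Proof.
pose g (k : 'I_(csize i)) : R := (is_edge k)%:R * cross (node Y (vidx k)) (edge_dst k - edge_src k).
pose g' (k : 'I_(csize i)) : R :=
  (is_edge k)%:R * cross (node Y (vidx (ordS k))) (edge_dst k - edge_src k).
transitivity (2^-1 * (\sum_k g k + \sum_k g' (ord_pred k))).
  rewrite -big_split mulr_sumr; apply: eq_bigr => k _ /=.
  have -> : mu k * dot (node Y (vidx k)) (vertex_normal k) =
      dot (node Y (vidx k)) (mu k *: vertex_normal k) by rewrite /dot !mxE; ring.
  rewrite mu_vertex_normal /g /g' ord_predK -!dot_perp /dot !mxE; ring.
congr (_ * _).
(* The cyclic shift moves the incoming half of each vertex term back to the edge it comes from. *)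
have -> : \sum_k g' (ord_pred k) = \sum_k g' k.
  rewrite [RHS](reindex (@ord_pred (csize i)))//.
  by exists (@ordS (csize i)) => k _; [exact: ord_predK|exact: ordSK].
rewrite -big_split/=.
rewrite [RHS]big_mkcond; apply: eq_bigr => k _; rewrite /g /g'.
by case: ifP => _; rewrite ?mul1r ?mul0r ?addr0 // /cross !mxE; ring.
Qed.

(** Edge by edge the two sides differ by an increment of [tau]. On an open curve the end values
    would survive, so the increments are regrouped by [sum_phase_antisym] into the closed boundaries
    of the regions, where the junction terms cancel too. *)
Lemma polar_area_flux p (Y : 'cV[R]_(N * 2)) :
  polar_area p (vpos G) Y =
  - \sum_(i < ncurves G) incidence p i *
      \sum_(k < csize i) mu k * dot (node Y (vidx k)) (vertex_normal k).
Proof.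
pose tau j := cross (node Y j) (vtx j).
have tau0 : \sum_(i < ncurves G) incidence p i *
    \sum_(k < csize i | is_edge k) (tau (vidx (ordS k)) - tau (vidx k)) = 0.
  have anti (u v : 'I_N) : tau u - tau v = - (tau v - tau u) by ring.
  have := sum_phase_antisym p (F := fun u v => tau v - tau u) anti.
  rewrite big1 => [/esym/eqP|r _]; last first.
    rewrite -(sum_edges (bdry r) (fun u v => tau v - tau u)).
    exact: (sum_edges_telescope (bdry_uniq hG r) tau).
  by rewrite oppr_eq0 => /eqP.
rewrite /polar_area mulrN; congr (- _).
under [in RHS]eq_bigr do rewrite sum_mu_vertex_normal mulrCA.
rewrite -mulr_sumr; congr (_ * _); apply/eqP.
rewrite -subr_eq0 -sumrB -oppr_eq0 -sumrN -[eqbRHS]tau0.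
apply/eqP; apply: eq_bigr => i _; rewrite -mulrBr -mulrN; congr (_ * _).
rewrite -sumrB -sumrN; apply: eq_bigr => k _.
by rewrite /tau /edge_dst /edge_src /cross !mxE; ring.
Qed.

Lemma sum_mxtens (m n : nat) (F : 'I_(m * n) -> R) :
  \sum_b F b = \sum_(i < m) \sum_(j < n) F (mxtens_index (i, j)).
Proof.
rewrite pair_bigA (reindex (@mxtens_index m n)); last first.
  by exists (@mxtens_unindex m n) => x _; rewrite ?mxtens_indexK ?mxtens_unindexK.
by apply: eq_bigr => -[].
Qed.

Lemma sum_curve_vertices (F : forall i : 'I_(ncurves G), 'I_(csize i) -> R) :
  \sum_(a < \sum_(i < ncurves G) csize i) F (cidx a) (kidx a) =
  \sum_(i < ncurves G) \sum_(k < csize i) F i k.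
Proof.
rewrite [RHS]sig_big_dep (reindex (@tagnat.sig _ (@csize R G))) /=.
  by apply: eq_bigr => a _; rewrite tagnat.sigE12.
exact: onW_bij tagnat.sig_bij.
Qed.

Lemma dvecE p (a : 'I_(\sum_(i < ncurves G) csize i)) :
  dvec p a 0 = incidence p (cidx a).
Proof.
rewrite /dvec mxE sum_mxtens.
have E q j : ((delta_mx p 0 : 'cV[R]_(nphases G)) *t (const_mx 1 : 'cV[R]_N))
    (mxtens_index (q, j)) 0 = (q == p)%:R.
  by rewrite !mxE mxtens_indexK/= !ord1 eqxx andbT mulr1.
rewrite (bigD1 p)//= [X in _ + X]big1 ?addr0 => [|q qp]; last first.
  by apply: big1 => j _; rewrite E (negbTE qp) mulr0.
rewrite (bigD1 (vidx (kidx a)))//= [X in _ + X]big1 => [|j jv].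
  by rewrite E eqxx mulr1 !mxE mxtens_indexK/= eqxx mulr1 addr0.
by rewrite E eqxx mulr1 !mxE mxtens_indexK/= eq_sym (negbTE jv) mulr0.
Qed.

Lemma BnE (Y : 'cV[R]_(N * 2)) (a : 'I_(\sum_(i < ncurves G) csize i)) :
  (Bn G *m Y) a 0 = dot (node Y (vidx (kidx a))) (vertex_normal (kidx a)).
Proof.
rewrite mxE sum_mxtens (bigD1 (vidx (kidx a)))//= [X in _ + X]big1 ?addr0 => [|j jv].
  rewrite big_ord_recl big_ord_recl big_ord0 addr0 !mxE !mxtens_indexK/= eqxx !mul1r.
  rewrite /dot !mxE mulrC [X in _ + X]mulrC.
  by have -> : lift ord0 ord0 = 1 :> 'I_2 by apply/val_inj.
by apply: big1 => c _; rewrite !mxE mxtens_indexK/= eq_sym (negbTE jv) !mul0r.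
Qed.

Lemma flux_sum p (Y : 'cV[R]_(N * 2)) :
  ((dvec p)^T *m Mv G *m (Bn G *m Y)) 0 0 =
  \sum_(i < ncurves G) incidence p i *
    \sum_(k < csize i) mu k * dot (node Y (vidx k)) (vertex_normal k).
Proof.
under [RHS]eq_bigr do rewrite mulr_sumr.
rewrite -(sum_curve_vertices (fun i k => incidence p i *
  (mu k * dot (node Y (vidx k)) (vertex_normal k)))).
rewrite mxE; apply: eq_bigr => a _.
rewrite BnE mul_mx_diag mxE [(dvec p)^T _ _]mxE dvecE [(\row__ _) _ _]mxE.
by rewrite mulrA.
Qed.

Lemma is_derive_phase_area p (Y : 'cV[R]_(N * 2)) :
  is_derive (vpos G) Y (phase_area G p) (polar_area p (vpos G) Y).
Proof.
apply: is_derive_line.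
have D := is_derive_fD (is_derive_affine (phase_area G p (vpos G)) (polar_area p (vpos G) Y) 0)
  (is_derive_fM (is_derive_fM (is_derive_id (0 : R) 1) (is_derive_id (0 : R) 1))
    (is_derive_cst (phase_area G p Y) (0 : R) 1)).
rewrite (_ : (fun _ => _) = (fun h : R => phase_area G p (vpos G) + h * polar_area p (vpos G) Y
    + h * h * phase_area G p Y)).
  by apply: is_derive_eq D _; rewrite /cst; ring.
by apply/funext => h; rewrite phase_area_expand expr2.
Qed.

End PhaseArea.

(** * Conservation of the phase areas *)

Theorem proposition6p7 (R : realType) (G : network R)
  (hG : polygonal_network G)
  (dt : R) (hdt : 0 < dt)
  (hV : forall r : 'I_(nbounded G).+1, r != ord_max ->
          region_single_layer_mx G r \in unitmx)
  (W : 'cV[R]_(nphases G * nverts G)) (X : 'cV[R]_(nverts G * 2))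
  (hWX : ((1%:M : 'M[R]_(nphases G)) *t Lambda G) *m W
         - dt^-1 *: (Dh G *m Mv G *m Bn G *m (X - vpos G)) = 0) :
  let dX := X - vpos G in
  let vn := dt^-1 *: (Bn G *m dX) in
  forall p : 'I_(nphases G), (1 <= p)%N ->
    [/\ is_derive (vpos G) dX (phase_area G p)
          (- dt * ((dvec p)^T *m Mv G *m vn) 0 0),
        - dt * ((dvec p)^T *m Mv G *m vn) 0 0 = 0
      & phase_area G p X - phase_area G p (vpos G) = phase_area G p dX].
Proof.
move=> dX vn p _.
have flux : - dt * ((dvec p)^T *m Mv G *m vn) 0 0 = polar_area p (vpos G) dX.
  have -> : (dvec p)^T *m Mv G *m vn = dt^-1 *: ((dvec p)^T *m Mv G *m (Bn G *m dX)).
    by rewrite /vn -scalemxAr.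
  by rewrite (polar_area_flux hG) -flux_sum mxE mulrA mulNr mulfV ?mulN1r// gt_eqF.
have zero : ((dvec p)^T *m Mv G *m vn) 0 0 = 0.
  rewrite /vn -scalemxAr {1}/dvec trmx_mul trmxK -!mulmxA scalemxAr.
  have -> : dt^-1 *: (Dh G *m (Mv G *m (Bn G *m dX))) =
      ((1%:M : 'M[R]_(nphases G)) *t Lambda G) *m W.
    by apply/esym/eqP; rewrite -subr_eq0 !mulmxA hWX.
  (* The mixed product rule reduces the Kronecker product to 1^T Lambda = 0 in the block of phase
     [p]. *)
  have cons : ((delta_mx p 0 : 'cV[R]_(nphases G)) *t (const_mx 1 : 'cV[R]_(nverts G)))^T
      *m ((1%:M : 'M[R]_(nphases G)) *t Lambda G) = 0.
    by rewrite trmx_tens tensmx_mul const1_Lambda// tensmx0.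
  rewrite mulmxA [X in X *m W]cons.
  by rewrite mul0mx mxE.
split; first by rewrite flux; exact: is_derive_phase_area.
  by rewrite zero mulr0.
(* The quadratic expansion is taken at [h = 1], where the linear term is the vanishing flux. *)
have XE : X = vpos G + 1 *: dX by rewrite scale1r addrC subrK.
have := phase_area_expand hG p (vpos G) dX 1.
rewrite -XE -flux zero mulr0 mulr0 addr0 expr1n mul1r => ->.
by rewrite addrC addKr.
Qed.
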